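(* Let $0<\mu\le1$ and $u_0\in M^{p,\ell}(\mathbb{R}^N)$ for some $1\le p<\infty$, $0<\ell\le N$. Assume that either $\ell=N$ and $1<p<\infty$, or $\ell<N$ and $u_0$ satisfies at least one of the following conditions: (i) $u_0$ is the limit in $M^{p,\ell}(\mathbb{R}^N)$ of a sequence $\{u_{0n}\}\subset M^{z,\nu}(\mathbb{R}^N)\cap M^{p,\ell}(\mathbb{R}^N)$ for some $1\le z\le\infty$, $0<\ell\le\nu\le N$ satisfying $\frac\ell p<\frac\nu z$; (ii) $(1-\chi_{B(x,r)})u_0\in M^{z,\nu}(\mathbb{R}^N)$ for some $x\in\mathbb{R}^N$, $r>0$ and some $1\le z\le\infty$, $0<\ell\le\nu\le N$ satisfying $\frac\ell p<\frac\nu z$; (iii) $\|(1-\chi_{B(x,r)})u_0\|_{M^{p,\ell}(\mathbb{R}^N)}\to0$ as $r\to\infty$ for some $x\in\mathbb{R}^N$. Then $\|S_\mu(t)u_0\|_{M^{p,\ell}(\mathbb{R}^N)}\to0$ as $t\to\infty$. Consequently, $\|S_\mu(t)u_0\|_{M^{q,s}(\mathbb{R}^N)}\to0$ as $t\to\infty$ for all $1\le q\le\infty$ and $0<s\le\ell$ satisfying $\frac sq=\frac\ell p$.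
   Context: $\chi_{B(x,r)}$ is the characteristic function of the ball $B(x,r)\subset\mathbb{R}^N$. Morrey spaces: for $1\le p<\infty$, $0\le \ell\le N$, $M^{p,\ell}(\mathbb{R}^N)$ is the space of $\phi\in L^p_{loc}(\mathbb{R}^N)$ with $\|\phi\|_{M^{p,\ell}}:=\sup_{x_0\in\mathbb{R}^N,R>0}R^{\frac{\ell-N}{p}}\|\phi\|_{L^p(B(x_0,R))}<\infty$; $M^{\infty,\ell}(\mathbb{R}^N):=L^\infty(\mathbb{R}^N)$. In particular $M^{p,N}(\mathbb{R}^N)=L^p(\mathbb{R}^N)$. Fractional heat semigroup (for $u_t+(-\Delta)^\mu u=0$): $S_\mu(t)u_0(x)=\int_{\mathbb{R}^N}k_\mu(t,x-y)u_0(y)\,dy$, $k_\mu(t,x)=(2\pi)^{-N}\int_{\mathbb{R}^N}e^{ix\cdot\xi-t|\xi|^{2\mu}}\,d\xi$, $t>0$. *)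

(* Defs.v *)
From HB Require Import structures.
From mathcomp Require Import all_boot all_order all_algebra.
From mathcomp Require Import all_classical all_reals all_analysis.
From mathcomp Require Import measurable_realfun complex.

Set Implicit Arguments.
Unset Strict Implicit.
Unset Printing Implicit Defensive.
Import Order.TTheory GRing.Theory Num.Theory.
Import numFieldNormedType.Exports.

Local Open Scope classical_set_scope.
Local Open Scope ring_scope.

Section measurable_rV.
Context {R : realType} {n : nat}.

Let coors : 'I_n -> 'rV[R]_n -> R := fun i x => x ord0 i.

Let rV_set0 : g_sigma_preimage coors set0.
Proof. exact: sigma_algebra0. Qed.

Let rV_setC A : g_sigma_preimage coors A -> g_sigma_preimage coors (~` A).
Proof. exact: sigma_algebraC. Qed.

Let rV_bigcup (F : _^nat) : (forall i, g_sigma_preimage coors (F i)) ->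
  g_sigma_preimage coors (\bigcup_i (F i)).
Proof. exact: sigma_algebra_bigcup. Qed.


(* The product sigma-algebra on R^n, generated by the coordinates; since R is
   second countable it is the Borel sigma-algebra of R^n. *)
HB.instance Definition _ :=
  @isMeasurable.Build (measure_tuple_display default_measure_display)
    'rV[R]_n (g_sigma_preimage coors) rV_set0 rV_setC rV_bigcup.

End measurable_rV.

Section lebesgue_rV.
Context {R : realType}.

Lemma measurable_coord n (i : 'I_n) :
  measurable_fun [set: 'rV[R]_n] (fun x : 'rV[R]_n => x ord0 i).
Proof.
move=> _ Y mY; rewrite setTI; apply: sub_sigma_algebra => /=.
rewrite -bigcup_seq/=; exists i => /=; first by rewrite mem_index_enum.
by exists Y => //; rewrite setTI.
Qed.

Lemma measurable_rVP d (T : measurableType d) n (f : T -> 'rV[R]_n) :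
  (forall i, measurable_fun [set: T] (fun x => f x ord0 i)) ->
  measurable_fun [set: T] f.
Proof.
move=> mf _ A; rewrite setTI; move: A; apply: smallest_sub.
  split; first by rewrite /= preimage_set0.
  - by move=> A /= mA; rewrite setTD preimage_setC; exact: measurableC.
  - by move=> F /= mF; rewrite preimage_bigcup; exact: bigcup_measurable.
case: n f mf => [|n] f mf; first by rewrite big_ord0.
rewrite -bigcup_mkord_ord; apply: bigcup_sub => i _ A [B mB <-] /=.
by rewrite setTI -comp_preimage -[X in measurable X]setTI; exact: mf.
Qed.

Definition cons_rV n (p : measurableTypeR R * 'rV[R]_n) : 'rV[R]_n.+1 :=
  row_mx (\row_(_ < 1) (p.1 : R)) p.2.

Lemma cons_rV0 n p : @cons_rV n p ord0 ord0 = p.1.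
Proof. by rewrite mxE; case: splitP => // j _; rewrite mxE. Qed.

Lemma cons_rVS n p i : @cons_rV n p ord0 (lift ord0 i) = p.2 ord0 i.
Proof.
rewrite mxE; case: splitP => [[[|//] ?] //|j /= [ij]].
by congr (p.2 _ _); exact/val_inj.
Qed.

Lemma measurable_cons_rV n : measurable_fun setT (@cons_rV n).
Proof.
apply: measurable_rVP => i.
case: (unliftP ord0 i) => [j ->|->].
  under eq_fun do rewrite cons_rVS.
  exact: measurableT_comp (measurable_coord j) measurable_snd.
under eq_fun do rewrite cons_rV0.
exact: measurable_fst.
Qed.

Definition uncons_rV n (x : 'rV[R]_n.+1) : measurableTypeR R * 'rV[R]_n :=
  (x ord0 ord0, \row_i x ord0 (lift ord0 i)).

Lemma cons_rVK n : cancel (@cons_rV n) (@uncons_rV n).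
Proof.
move=> [a v]; rewrite /uncons_rV cons_rV0; congr pair.
by apply/rowP => i; rewrite mxE cons_rVS.
Qed.

Lemma measurable_uncons_rV n : measurable_fun setT (@uncons_rV n).
Proof.
apply/measurable_fun_pairP; split; first exact: measurable_coord.
apply: measurable_rVP => i /=; under eq_fun do rewrite mxE.
exact: measurable_coord.
Qed.

Section cons_measure.
Context {n : nat} (mu : {sigma_finite_measure set 'rV[R]_n -> \bar R}).
Local Open Scope ereal_scope.

Definition cons_measure : set 'rV[R]_n.+1 -> \bar R :=
  pushforward (@lebesgue_measure R \x mu) (@cons_rV n).

HB.instance Definition _ := Measure.copy cons_measure
  (measure_function_pushforward__canonical__measure_function_Measure
    (@lebesgue_measure R \x mu) (@measurable_cons_rV n)).

Let cons_measure_sigma_finite : sigma_finite setT cons_measure.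
Proof.
have /sigma_finiteP[F [TF ndF Foo]] := sigma_finiteT (@lebesgue_measure R).
have /sigma_finiteP[G [TG ndG Goo]] := sigma_finiteT mu.
exists (fun k => @uncons_rV n @^-1` (F k `*` G k)) => [|k].
  apply/esym/seteqP; split => // x _.
  have [k _ Fk] : (\bigcup_k F k) (x ord0 ord0) by rewrite -TF.
  have [m _ Gm] : (\bigcup_k G k) (uncons_rV x).2 by rewrite -TG.
  exists (maxn k m) => //; split => /=.
    by move: Fk; exact/subsetPset/ndF/leq_maxl.
  by move: Gm; exact/subsetPset/ndG/leq_maxr.
have [[mF Fk] [mG Gk]] := (Foo k, Goo k); split.
  rewrite -[X in measurable X]setTI; apply: measurable_uncons_rV => //.
  exact: measurableX.
rewrite /cons_measure /pushforward -comp_preimage.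
rewrite (_ : uncons_rV (n:=n) \o _ = id); last exact/funext/cons_rVK.
by rewrite preimage_id product_measure1E// lte_mul_pinfty// ge0_fin_numE.
Qed.

HB.instance Definition _ :=
  Measure_isSigmaFinite.Build _ _ _ cons_measure cons_measure_sigma_finite.

End cons_measure.

(* Lebesgue measure on R^n: the n-fold product of the one-dimensional one,
   see lebesgue_rV_box. *)
Fixpoint lebesgue_rV n : {sigma_finite_measure set 'rV[R]_n -> \bar R} :=
  if n is m.+1 then cons_measure (lebesgue_rV m)
  else \d_(0 : 'rV[R]_0).

Lemma lebesgue_rV_box n (A : 'I_n -> set R) :
  (forall i, measurable (A i)) ->
  lebesgue_rV n [set x | forall i, A i (x ord0 i)] =
  (\prod_(i < n) lebesgue_measure (A i))%E.
Proof.
elim: n A => [|n IHn] A mA.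
  by rewrite big_ord0 /= diracE mem_set// => -[].
have mB : measurable [set x : 'rV[R]_n | forall i, A (lift ord0 i) (x ord0 i)].
  rewrite (_ : [set _ | _] = \bigcap_(i in [set: 'I_n])
    (fun x : 'rV[R]_n => x ord0 i) @^-1` A (lift ord0 i)); last first.
    by apply/seteqP; split => x /= h i => [_|]; exact: h.
  apply: fin_bigcap_measurable => // i _.
  by rewrite -[X in measurable X]setTI; exact: measurable_coord.
rewrite big_ord_recl -IHn// -product_measure1E//=; last exact: mA.
rewrite /cons_measure /pushforward; congr (product_measure1 _ _ _).
apply/seteqP; split => [[a v] /= h|[a v] /= [h0 h] i].
  split; first by have := h ord0; rewrite cons_rV0.
  by move=> i; have := h (lift ord0 i); rewrite cons_rVS.
by case: (unliftP ord0 i) => [j ->|->]; rewrite ?cons_rVS ?cons_rV0.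
Qed.

Lemma measurable_oppr_rV n : measurable_fun setT (-%R : 'rV[R]_n -> 'rV[R]_n).
Proof.
apply: measurable_rVP => i; under eq_fun do rewrite mxE.
exact: measurableT_comp (measurable_coord i).
Qed.

Lemma lebesgue_rVN n (A : set 'rV[R]_n) : measurable A ->
  lebesgue_rV n (-%R @^-1` A) = lebesgue_rV n A.
Proof.
elim: n A => [|n IHn] A mA.
  by congr (lebesgue_rV 0 _); apply/seteqP; split => x /=; rewrite !thinmx0.
rewrite /= /cons_measure /pushforward -comp_preimage.
pose opp2 (p : measurableTypeR R * 'rV[R]_n) : measurableTypeR R * 'rV[R]_n :=
  (- (p.1 : R), - p.2).
have mopp2 : measurable_fun setT opp2.
  apply/measurable_fun_pairP; split.
    exact: (@measurableT_comp _ _ _ _ _ _ (-%R : R -> R)) measurable_fst.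
  exact: measurableT_comp (@measurable_oppr_rV n) measurable_snd.
rewrite (_ : -%R \o _ = @cons_rV n \o opp2); last first.
  apply/funext => p; apply/rowP => i /=; rewrite mxE.
  by case: (unliftP ord0 i) => [j ->|->]; rewrite ?cons_rVS ?cons_rV0 ?mxE.
pose m' : {measure set (measurableTypeR R * 'rV[R]_n) -> \bar R} :=
  measure_function_pushforward__canonical__measure_function_Measure
    (@lebesgue_measure R \x lebesgue_rV n)%E mopp2.
have mC : measurable (@cons_rV n @^-1` A).
  by rewrite -[X in measurable X]setTI; exact: measurable_cons_rV.
rewrite comp_preimage; apply/esym.
apply: (@product_measure_unique _ _ _ _ _ _ _ m') => // B C mB mC'.
rewrite /m' /= /pushforward.
rewrite (_ : opp2 @^-1` _ = (-%R @^-1` B) `*` (-%R @^-1` C))//.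
rewrite product_measure1E ?IHn//.
- by congr (_ * _)%E; exact: lebesgue_measureN.
- rewrite -[X in measurable X]setTI.
  exact: (oppr_measurable (measurableT : measurable (setT : set R))).
- by rewrite -[X in measurable X]setTI; exact: measurable_oppr_rV.
Qed.

Lemma Rintegral_odd n (f : 'rV[R]_n -> R) : measurable_fun setT f ->
  (forall x, f (- x) = - f x) -> \int[lebesgue_rV n]_x f x = 0.
Proof.
move=> mf fN; rewrite /Rintegral integralE.
have -> : (\int[lebesgue_rV n]_x (EFin \o f)^\- x =
           \int[lebesgue_rV n]_x (EFin \o f)^\+ x)%E.
  transitivity (\int[pushforward (lebesgue_rV n) (-%R : 'rV[R]_n -> 'rV[R]_n)]_x
      ((EFin \o f)^\- x))%E.
    pose m' := measure_function_pushforward__canonical__measure_function_Measure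
      (lebesgue_rV n) (@measurable_oppr_rV n).
    apply: (@eq_measure_integral _ _ _ _ m') => A mA _ /=.
    exact/esym/lebesgue_rVN.
  rewrite ge0_integral_pushforward//; last 2 first.
  - exact: measurable_oppr_rV.
  - exact/measurable_funeneg/measurable_EFinP.
  by apply: eq_integral => x _ /=; rewrite funenegE funeposE /= fN opprK.
by case: (integral _ _ _) => [r||] //=; rewrite subrr.
Qed.

End lebesgue_rV.

Section heat_semigroup.
Context {R : realType} {N : nat}.
Implicit Types (x y xi : 'rV[R]_N) (mu t : R).

Definition dotp x y : R := \sum_(i < N) x ord0 i * y ord0 i.

(* The norm `|x| of 'rV[R]_N in the library is the sup norm; |x| and the balls
   B(x, r) here are the Euclidean ones. *)
Definition enorm x : R := Num.sqrt (dotp x x).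

Definition eball x (r : R) : set 'rV[R]_N := [set y | enorm (y - x) < r].

Definition cexp (z : R[i]) : R[i] :=
  (expR (complex.Re z) * cos (complex.Im z) +i* (expR (complex.Re z) * sin (complex.Im z)))%C.

Definition Cintegral (f : 'rV[R]_N -> R[i]) : R[i] :=
  ((\int[lebesgue_rV N]_y complex.Re (f y)) +i* (\int[lebesgue_rV N]_y complex.Im (f y)))%C.

Definition heat_kernelC mu t x : R[i] :=
  ((2 * pi) ^- N)%:C%C *
  Cintegral (fun xi =>
    cexp ('i%C * (dotp x xi)%:C%C - (t * enorm xi `^ (2 * mu))%:C%C)).

(* The kernel is real-valued, see heat_kernelCE. *)
Definition heat_kernel mu t x : R := complex.Re (heat_kernelC mu t x).

Lemma measurable_dotp d (T : measurableType d) (f g : T -> 'rV[R]_N) :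
  measurable_fun setT f -> measurable_fun setT g ->
  measurable_fun setT (fun z => dotp (f z) (g z)).
Proof.
move=> mf mg; apply: measurable_sum => i.
by apply: measurable_funM; exact: measurableT_comp (measurable_coord i) _.
Qed.

Lemma heat_kernelCE mu t x : heat_kernelC mu t x = (heat_kernel mu t x)%:C%C.
Proof.
rewrite /heat_kernel /heat_kernelC /Cintegral.
set I1 := \int[_]_y _; set I2 := \int[_]_y _.
suff -> : I2 = 0 by apply/eqP; rewrite eq_complex /= !(mul0r, mulr0, addr0) !eqxx.
rewrite {}/I2.
pose g xi := expR (- (t * enorm xi `^ (2 * mu))) * sin (dotp x xi).
under eq_Rintegral => xi _.
  rewrite (_ : complex.Im _ = g xi); last first.
    by rewrite /g /= !(mul0r, mul1r, mulr0, sub0r, subr0, oppr0, add0r, addr0).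
  over.
have dotN y xi : dotp y (- xi) = - dotp y xi.
  by rewrite /dotp -sumrN; apply: eq_bigr => i _; rewrite mxE mulrN.
have dotC y xi : dotp y xi = dotp xi y.
  by apply: eq_bigr => i _; rewrite mulrC.
apply: Rintegral_odd => [|xi]; last first.
  by rewrite /g /enorm dotN (dotC (- xi)) !dotN opprK sinN mulrN.
apply: measurable_funM.
  apply: (measurableT_comp (@measurable_expR R)).
  under eq_fun do rewrite -mulNr.
  apply: measurable_funM => //.
  apply: (measurableT_comp (@measurable_powR R _)).
  apply: (@measurableT_comp _ _ _ _ _ _ (@Num.sqrt R)).
    by apply: continuous_measurable_fun; exact: sqrt_continuous.
  exact: measurable_dotp.
apply: (@measurableT_comp _ _ _ _ _ _ (@sin R)).
  by apply: continuous_measurable_fun; exact: continuous_sin.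
exact: measurable_dotp.
Qed.

Definition heat_semigroup mu t (u0 : 'rV[R]_N -> R) : 'rV[R]_N -> R :=
  fun x => \int[lebesgue_rV N]_y (heat_kernel mu t (x - y) * u0 y).

End heat_semigroup.

Section morrey.
Context {R : realType} {N : nat}.
Implicit Types (f : 'rV[R]_N -> R) (p : \bar R) (l : R).
Local Open Scope ereal_scope.

Definition in_Lloc p f : Prop :=
  measurable_fun [set: 'rV[R]_N] f /\
  forall K : set 'rV[R]_N, compact K ->
    'N[lebesgue_rV N]_p[EFin \o (\1_K \* f)%R] < +oo.

Definition morrey_norm p l f : \bar R :=
  match p with
  | r%:E => ereal_sup
      [set ((rho `^ ((l - N%:R) / r))%R)%:E *
           'N[lebesgue_rV N]_(r%:E)[EFin \o (\1_(eball x0 rho) \* f)%R]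
      | x0 in [set: 'rV[R]_N] & rho in [set rho : R | (0 < rho)%R]]
  | _ => 'N[lebesgue_rV N]_p[EFin \o f]
  end.

Definition in_morrey p l f : Prop := in_Lloc p f /\ morrey_norm p l f < +oo.

(* The norm of M^{p,l} is only meant for functions of L^p_loc, so that writing
   that the norm of u t tends to 0 includes the membership of u t. *)
Definition morrey_vanishes p l (u : R -> 'rV[R]_N -> R) : Prop :=
  (\forall t \near +oo%R, in_morrey p l (u t)) /\
  morrey_norm p l (u t) @[t --> +oo%R] --> 0.

Definition off_ball (x : 'rV[R]_N) (r : R) f : 'rV[R]_N -> R :=
  fun y => ((1 - \1_(eball x r) y) * f y)%R.

End morrey.

(* Main.v *)
Require Import Defs.
From mathcomp Require Import all_boot all_order all_algebra.
From mathcomp Require Import all_classical all_reals all_analysis.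
From mathcomp Require Import measurable_realfun ring lra.

(** The norm of [M^{p,l}] bounds the growth of [|f|^p] on balls:
    [\int_{B(x,r)} |f|^p <= A^p r^(N-l)] for all [x] and [r] ([morrey_bound]).
    All estimates are made on this form.

    With [T = t^(1/(2mu))] and some [0 < del < 1], the kernel obeys
    [|k(t,x)| <= C T^-N] and [|k(t,x)| <= C T^del |x|^-(N+del)]
    ([heat_kernel_bounds]).  The first one holds because the
    integral of [F_T(xi) = exp(-|T xi|^(2mu))] is [O(T^-N)].  For the second, a shift of the frequency
    by [h = (pi/|x_i|) e_i] reverses the sign of [cos(x.xi)], so the cosine
    transform of [F_T] is at most the [L^1] norm of the finite difference
    [Delta_h^n F_T], of any order [n] ([normr_Rintegral_cos_le]).  Take
    [n = N+1].  Away from the origin [F_1] is smooth along coordinate lines and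
    its [n]-th derivative is [O(|xi|^(del-n))], so the difference is
    [O(|h|^n |xi|^(del-n))]; within a distance of order [|h|] of the origin it is
    [O(|h|^del)], because [|F_1 - 1| <= |xi|^del].  For [T = 1] the
    integrals of the two bounds add up to [O(|h|^(N+del))], and [|h|] is comparable to [1/|x|] when
    [x_i] is the largest coordinate.

    Cutting the complement of a ball into dyadic shells ([integral_tail_le])
    turns a growth bound on balls into a bound for the integral against a power
    of the distance.  Hence the kernel is uniformly in [L^1], the semigroup is
    uniformly bounded on [M^{p,l}] ([heat_semigroup_morrey_bound]), and it maps
    [M^{z,nu}] to bounded functions with norm [O(T^(-nu/z))]
    ([heat_semigroup_sup_le]).  Interpolating between the last two facts,
    applied to [M^{z,nu}], gives decay in [M^{q,nu}] for [q > z]; if [nu >= l] and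
    [nu/z > l/p], then [q = p nu/l] exceeds [z], and [M^{q,nu}] is included in
    [M^{p,l}].  So data in [M^{z,nu}] decay in [M^{p,l}]
    ([heat_smoothing_vanishes]).

    A truncation of [u0] to a ball lies in [L^1 = M^{1,N}], and [l/p < N] under
    either assumption of the theorem.  In each case [u0] is a sum of data
    covered by [heat_smoothing_vanishes], or is approximated by such data in
    [M^{p,l}] (by truncations if [l = N], since the tails of an [L^p] function
    are small), and uniform boundedness carries the decay over to the limit
    ([heat_vanishes_approx]).  The last claim is the inclusion of [M^{p,l}] in
    [M^{q,s}] for [s/q = l/p], [q <= p] ([morrey_bound_embed]). *)

Set Implicit Arguments.
Unset Strict Implicit.
Unset Printing Implicit Defensive.
Import Order.TTheory GRing.Theory Num.Theory.
Import numFieldNormedType.Exports.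

Local Open Scope classical_set_scope.
Local Open Scope ring_scope.

(** * Integrals over sets and with parameters *)

Section integration.
Context d (T : measurableType d) (R : realType) (m : {measure set T -> \bar R}).
Local Open Scope ereal_scope.

(** The integral of a nonnegative function is a supremum over the simple
    functions below it, hence monotone for arbitrary integrands. *)
Lemma le_integral_ge0 (D : set T) (f g : T -> \bar R) :
  (forall x, D x -> 0 <= f x) -> (forall x, D x -> f x <= g x) ->
  \int[m]_(x in D) f x <= \int[m]_(x in D) g x.
Proof.
move=> f0 fg.
have g0 x : D x -> 0 <= g x by move=> Dx; exact: le_trans (f0 x Dx) (fg x Dx).
rewrite !ge0_integralE//; apply: ge_ereal_sup => _ [h/= hf] <-.
apply: ereal_sup_ubound; exists h => //= x; apply: le_trans (hf x) _.
by rewrite /patch; case: ifPn => // /set_mem/fg.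
Qed.

(** If [f] is not integrable, then the right-hand side is infinite; the estimate
    can thus be used before integrability is known. *)
Lemma le_Rintegral_abs (f g : T -> R) : measurable_fun setT f ->
  (forall x, `|f x| <= g x)%R ->
  `| \int[m]_x f x |%:E <= \int[m]_x (g x)%:E.
Proof.
move=> mf fg; have mf' : measurable_fun setT (EFin \o f) by exact/measurable_EFinP.
apply: (@le_trans _ _ (\int[m]_x `|f x|%:E)); last first.
  by apply: le_integral_ge0 => x _; rewrite lee_fin.
have [foo|] := ltP (\int[m]_x `|f x|%:E) +oo; last first.
  by move=> h; apply: le_trans h; rewrite leey.
rewrite EFin_normr_Rintegral//; first exact: le_abse_integral.
by apply/integrableP.
Qed.

(** Tonelli applies to the positive and to the negative part of [f] separately;
    the real integral is a measurable function of the two results even where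
    they are both infinite. *)
Lemma measurable_Rintegral_param d' (T' : measurableType d')
    (n : {sigma_finite_measure set T -> \bar R}) (f : T' * T -> R) :
  measurable_fun setT f ->
  measurable_fun setT (fun x => \int[n]_y f (x, y))%R.
Proof.
move=> mf; apply: measurableT_comp => //=.
under eq_fun do rewrite integralE.
apply: emeasurable_funB.
- rewrite [X in measurable_fun _ X](_ : _ = fubini_F n (EFin \o f)^\+).
    by apply: measurable_fun_fubini_tonelli_F => //; exact/measurable_funepos/measurable_EFinP.
  by apply/funext => x; apply: eq_integral => y _; rewrite !funeposE.
- rewrite [X in measurable_fun _ X](_ : _ = fubini_F n (EFin \o f)^\-).
    by apply: measurable_fun_fubini_tonelli_F => //; exact/measurable_funeneg/measurable_EFinP.
  by apply/funext => x; apply: eq_integral => y _; rewrite !funenegE.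
Qed.

End integration.

Lemma integral_mul_indic d (T : measurableType d) (R : realType)
    (m : {measure set T -> \bar R}) (D : set T) (g : T -> R) :
  (\int[m]_x (\1_D x * g x)%:E = \int[m]_(x in D) (g x)%:E)%E.
Proof.
rewrite [RHS]integral_mkcond; apply: eq_integral => x _.
by rewrite /patch indicE; case: ifP => _; rewrite ?mul1r ?mul0r.
Qed.

(** * Invariance of Lebesgue measure on R^n *)

Section lebesgue_invariance.
Context {R : realType}.
Implicit Types n : nat.

Lemma measurable_addr_rV n (a : 'rV[R]_n) : measurable_fun setT (+%R a).
Proof.
apply: measurable_rVP => i; under eq_fun do rewrite mxE.
by apply: measurable_funD => //; exact: measurable_coord.
Qed.

Lemma measurable_sub_rV n :
  measurable_fun setT (fun u : 'rV[R]_n * 'rV[R]_n => u.1 - u.2).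
Proof.
apply: measurable_rVP => i; under eq_fun do rewrite !mxE.
apply: measurable_funB; apply: measurableT_comp (measurable_coord i) _.
  exact: measurable_fst.
exact: measurable_snd.
Qed.

Lemma lebesgue_measureD (a : R) (A : set R) : measurable A ->
  lebesgue_measure ((fun x => a + x) @^-1` A) = lebesgue_measure A.
Proof.
move=> mA.
have ma : measurable_fun [set: measurableTypeR R] (+%R a : _ -> measurableTypeR R).
  exact: measurable_funD.
pose m' := measure_function_pushforward__canonical__measure_function_Measure
  lebesgue_measure ma.
apply/esym/(@lebesgue_measure_unique _ m') => //= _ [[b c]] _ <-.
rewrite /pushforward.
have -> : +%R a @^-1` [set` `]b, c]] = [set` `](b - a), (c - a)]].
  by apply/seteqP; split => x /=; rewrite !in_itv/= => /andP[? ?];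
    apply/andP; split; lra.
rewrite !lebesgue_measure_itv/= !lte_fin.
rewrite ltrD2r -!EFinD (_ : c - a + - (b - a) = c - b)//; ring.
Qed.

(** By induction on the dimension, from uniqueness of the product measure. *)
Lemma lebesgue_rVD n (a : 'rV[R]_n) (A : set 'rV[R]_n) : measurable A ->
  lebesgue_rV n (+%R a @^-1` A) = lebesgue_rV n A.
Proof.
elim: n a A => [|n IHn] a A mA.
  congr (lebesgue_rV 0 _); apply/seteqP; split => x /=;
    by rewrite (_ : a + x = x) // [LHS]thinmx0 [RHS]thinmx0.
rewrite /= /cons_measure /pushforward -comp_preimage.
pose a2 := uncons_rV a.
pose add2 (p : measurableTypeR R * 'rV[R]_n) : measurableTypeR R * 'rV[R]_n :=
  ((a2.1 : R) + (p.1 : R), a2.2 + p.2).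
have madd2 : measurable_fun setT add2.
  apply/measurable_fun_pairP; split.
    by apply: measurable_funD; [exact: measurable_cst|exact: measurable_fst].
  exact: measurableT_comp (measurable_addr_rV a2.2) measurable_snd.
rewrite (_ : +%R a \o _ = @cons_rV _ n \o add2); last first.
  apply/funext => p; apply/rowP => i /=; rewrite mxE.
  by case: (unliftP ord0 i) => [j ->|->]; rewrite ?cons_rVS ?cons_rV0 ?mxE.
pose m' : {measure set (measurableTypeR R * 'rV[R]_n) -> \bar R} :=
  measure_function_pushforward__canonical__measure_function_Measure
    (@lebesgue_measure R \x lebesgue_rV n)%E madd2.
have mC : measurable (@cons_rV _ n @^-1` A).
  by rewrite -[X in measurable X]setTI; exact: measurable_cons_rV.
rewrite comp_preimage; apply/esym.
apply: (@product_measure_unique _ _ _ _ _ _ _ m') => // B C mB mC'.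
rewrite /m' /= /pushforward.
rewrite (_ : add2 @^-1` _ = (+%R (a2.1 : R) @^-1` B) `*` (+%R a2.2 @^-1` C))//.
rewrite product_measure1E ?IHn//.
- by congr (_ * _)%E; exact: lebesgue_measureD.
- rewrite -[X in measurable X]setTI.
  have : measurable_fun [set: R] (fun x : R => (a2.1 : R) + x).
    exact: measurable_funD.
  by apply.
- by rewrite -[X in measurable X]setTI; exact: measurable_addr_rV.
Qed.

Lemma ge0_integral_addr n (a : 'rV[R]_n) (f : 'rV[R]_n -> \bar R) :
  measurable_fun setT f -> (forall x, 0 <= f x)%E ->
  (\int[lebesgue_rV n]_x f (a + x)%R = \int[lebesgue_rV n]_x f x)%E.
Proof.
move=> mf f0; pose m' :=
  measure_function_pushforward__canonical__measure_function_Measure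
  (lebesgue_rV n) (measurable_addr_rV a).
transitivity (\int[m']_x f x)%E.
  by rewrite ge0_integral_pushforward//; exact: measurable_addr_rV.
by apply: (@eq_measure_integral _ _ _ _ (lebesgue_rV n)) => A mA _; exact: lebesgue_rVD.
Qed.

Lemma ge0_integral_subr n (a : 'rV[R]_n) (f : 'rV[R]_n -> \bar R) :
  measurable_fun setT f -> (forall x, 0 <= f x)%E ->
  (\int[lebesgue_rV n]_x f (a - x)%R = \int[lebesgue_rV n]_x f x)%E.
Proof.
move=> mf f0; rewrite -[RHS](ge0_integral_addr a)//.
have mg : measurable_fun setT (fun x => f (a + x)).
  exact: measurableT_comp (measurable_addr_rV a).
pose m' := measure_function_pushforward__canonical__measure_function_Measure
  (lebesgue_rV n) (@measurable_oppr_rV R n).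
transitivity (\int[m']_x f (a + x)%R)%E.
  by rewrite ge0_integral_pushforward//; exact: measurable_oppr_rV.
by apply: (@eq_measure_integral _ _ _ _ (lebesgue_rV n)) => A mA _; exact: lebesgue_rVN.
Qed.

Lemma Rintegral_addr n (a : 'rV[R]_n) (f : 'rV[R]_n -> R) :
  measurable_fun setT f ->
  \int[lebesgue_rV n]_x f (a + x) = \int[lebesgue_rV n]_x f x.
Proof.
move=> mf; congr fine; rewrite integralE [RHS]integralE.
have mf' : measurable_fun setT (EFin \o f) by exact/measurable_EFinP.
congr (_ - _)%E.
- rewrite -[RHS](ge0_integral_addr a)//; last exact: measurable_funepos.
  by apply: eq_integral => y _; rewrite !funeposE.
- rewrite -[RHS](ge0_integral_addr a)//; last exact: measurable_funeneg.
  by apply: eq_integral => y _; rewrite !funenegE.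
Qed.

End lebesgue_invariance.

(** * Real powers *)

Section powR.
Context {R : realType}.
Implicit Types a b r x y : R.

Lemma powR_le1 a r : 0 <= a -> 0 <= r -> r <= 1 -> r `^ a <= 1.
Proof.
move=> a0 r0 r1; have <- : (1 : R) `^ a = 1 by rewrite powR1.
by apply: ge0_ler_powR; rewrite ?nnegrE.
Qed.

Lemma powR_ge1 a r : 0 <= a -> 1 <= r -> 1 <= r `^ a.
Proof.
move=> a0 r1; have <- : (1 : R) `^ a = 1 by rewrite powR1.
rewrite ge0_ler_powR ?nnegrE//.
exact: le_trans r1.
Qed.

(** A negative exponent reverses the order. *)
Lemma ler_powR_neg a x y : a <= 0 -> 0 < x -> x <= y -> y `^ a <= x `^ a.
Proof.
move=> a0 x0 xy; have y0 : 0 < y by exact: lt_le_trans xy.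
rewrite -[a]opprK !(powRN _ (- a)) lef_pV2 ?posrE ?powR_gt0//.
by rewrite ge0_ler_powR ?nnegrE ?oppr_ge0 ?(ltW x0) ?(ltW y0).
Qed.

Lemma two_powR_lt1 a : a < 0 -> (2 : R) `^ a < 1.
Proof.
by move=> a0; rewrite /powR pnatr_eq0/= expR_lt1 nmulr_rlt0 ?ln_gt0 ?ltr1n.
Qed.

(** Either [a <= la], or [a > la] and [a^q = a^(q-p) a^p] with [q - p <= 0].
    Integrated and optimized in [la], this elementary inequality stands in for
    the inequalities of Hoelder and Jensen. *)
Lemma powR_young (p q a la : R) : q <= p -> 0 <= q -> 0 <= a -> 0 < la ->
  a `^ q <= la `^ q + la `^ (q - p) * a `^ p.
Proof.
move=> qp q0 a0 la0; have [ala|laa] := leP a la.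
  apply: (@le_trans _ _ (la `^ q)); first by apply: ge0_ler_powR; rewrite ?nnegrE ?(ltW la0).
  by rewrite lerDl mulr_ge0 ?powR_ge0.
have a_gt0 : 0 < a by exact: lt_trans laa.
apply: (@le_trans _ _ (la `^ (q - p) * a `^ p)); last by rewrite lerDr powR_ge0.
rewrite -[q in leLHS](subrK p) (@powRD _ a (q - p)) ?(gt_eqF a_gt0) ?implybT//.
rewrite ler_wpM2r ?powR_ge0//; apply: ler_powR_neg => //; last exact: ltW.
by rewrite subr_le0.
Qed.

(** The larger of [a] and [b] is at least [(a + b) / 2]. *)
Lemma powRD_le (p a b : R) : 0 <= p -> 0 <= a -> 0 <= b ->
  (a + b) `^ p <= 2 `^ p * (a `^ p + b `^ p).
Proof.
move=> p0 a0 b0; wlog ab : a b a0 b0 / a <= b => [hw|].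
  by have [/hw|/ltW/hw] := leP a b; [exact|rewrite addrC [X in _ * X]addrC; exact].
apply: (@le_trans _ _ ((2 * b) `^ p)).
  by apply: ge0_ler_powR; rewrite ?nnegrE ?addr_ge0 ?mulr_ge0// mulrDl mul1r lerD2r.
by rewrite powRM// ler_wpM2l ?powR_ge0// lerDr powR_ge0.
Qed.

Lemma powRN_small (H th e : R) : 0 <= H -> 0 < th -> 0 < e ->
  exists2 M, 0 < M & forall t, M <= t -> H * t `^ (- th) <= e.
Proof.
move=> H0 th0 e0; have He : 0 < H / e + 1 by rewrite ltr_wpDl// divr_ge0// ltW.
exists ((H / e + 1) `^ th^-1) => [|t Mt]; first exact: powR_gt0.
have t0 : 0 < t by apply: lt_le_trans Mt; exact: powR_gt0.
rewrite powRN ler_pdivrMr ?powR_gt0// -ler_pdivrMl// mulrC.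
apply: (@le_trans _ _ (H / e + 1)); first by rewrite lerDl.
have -> : H / e + 1 = ((H / e + 1) `^ th^-1) `^ th.
  by rewrite -powRrM mulVf ?gt_eqF// powRr1// ltW.
by apply: ge0_ler_powR; rewrite ?nnegrE ?powR_ge0 ?(ltW th0) ?(ltW t0).
Qed.

End powR.

(** * Euclidean balls and dyadic decomposition *)

Section euclid.
Context {R : realType} {N : nat}.
Implicit Types x y : 'rV[R]_N.
Local Notation L := (@lebesgue_rV R N).

Lemma dotpp_ge0 x : 0 <= dotp x x.
Proof. by apply: sumr_ge0 => i _; rewrite -expr2 sqr_ge0. Qed.

Lemma enorm_ge0 x : 0 <= enorm x.
Proof. exact: sqrtr_ge0. Qed.

Lemma sqr_enorm x : enorm x ^+ 2 = dotp x x.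
Proof. by rewrite sqr_sqrtr// dotpp_ge0. Qed.

Lemma enormN x : enorm (- x) = enorm x.
Proof.
by congr Num.sqrt; apply: eq_bigr => i _; rewrite !mxE mulrNN.
Qed.

Lemma enormZ (a : R) x : enorm (a *: x) = `|a| * enorm x.
Proof.
rewrite /enorm (_ : dotp _ _ = a ^+ 2 * dotp x x); last first.
  by rewrite /dotp mulr_sumr; apply: eq_bigr => i _; rewrite !mxE; ring.
by rewrite sqrtrM ?sqr_ge0// sqrtr_sqr.
Qed.

Lemma ler_coord_enorm x i : `|x ord0 i| <= enorm x.
Proof.
rewrite -sqrtr_sqr; apply: ler_wsqrtr; rewrite /dotp (bigD1 i)//= -expr2 lerDl.
by apply: sumr_ge0 => j _; rewrite -expr2 sqr_ge0.
Qed.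

Lemma enorm_le_coord x (K : R) : 0 <= K -> (forall i, `|x ord0 i| <= K) ->
  enorm x <= N%:R * K.
Proof.
move=> K0 xK; rewrite -(ler_pXn2r (ltn0Sn 1)) ?nnegrE ?mulr_ge0 ?enorm_ge0//.
rewrite sqr_enorm; apply: (@le_trans _ _ (\sum_(i < N) K ^+ 2)).
  apply: ler_sum => i _; rewrite -expr2 -real_normK ?num_real//.
  by rewrite ler_pXn2r ?nnegrE.
rewrite sumr_const card_ord -[leLHS]mulr_natl exprMn ler_wpM2r ?sqr_ge0//.
by rewrite -natrX ler_nat; case: (N) => // k; rewrite expnS expn1 leq_pmulr.
Qed.

(** A largest coordinate controls the norm; it selects the direction in which
    the frequency is shifted. *)
Lemma enorm_le_max_coord x : 0 < enorm x -> exists i, enorm x <= N%:R * `|x ord0 i|.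
Proof.
move=> x0; have [i _|N0] := pickP (pred_of_simpl (@predT 'I_N)); last first.
  suff : enorm x = 0 by move=> e; rewrite e ltxx in x0.
  rewrite /enorm /dotp big1 ?sqrtr0// => i _.
  by have := N0 i.
exists [arg max_(j > i) `|x ord0 j|]%O; case: Order.TotalTheory.arg_maxP => //= j _ xj.
by apply: enorm_le_coord => // k; exact: xj.
Qed.

Lemma measurable_enorm d (T : measurableType d) (f : T -> 'rV[R]_N) :
  measurable_fun setT f -> measurable_fun setT (fun z => enorm (f z)).
Proof.
move=> mf; apply: (@measurableT_comp _ _ _ _ _ _ (@Num.sqrt R)).
  by apply: continuous_measurable_fun; exact: sqrt_continuous.
exact: measurable_dotp.
Qed.

Lemma measurable_subr_rV y : measurable_fun setT (fun x => x - y).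
Proof.
apply: measurable_rVP => i; under eq_fun do rewrite mxE.
by apply: measurable_funD => //; exact: measurable_coord.
Qed.

Lemma measurable_eball x (r : R) : measurable (eball x r).
Proof.
have := measurable_enorm (measurable_subr_rV x).
move=> /(_ measurableT `]-oo, r[%classic (measurable_itv _)).
by rewrite setTI.
Qed.

(** The Euclidean ball lies in a cube of side [2r]. *)
Lemma lebesgue_eball x (r : R) : 0 <= r -> (L (eball x r) <= ((2 * r) ^+ N)%:E)%E.
Proof.
move=> r0.
pose I i : set R := `[x ord0 i - r, x ord0 i + r]%classic.
pose B := \bigcap_(i in [set: 'I_N]) (fun x : 'rV[R]_N => x ord0 i) @^-1` I i.
have mB : measurable B.
  apply: fin_bigcap_measurable => // i _.
  by rewrite -[X in measurable X]setTI; apply: measurable_coord => //; exact: measurable_itv.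
apply: (@le_trans _ _ (L B)).
  apply: le_measure; rewrite ?inE//; first exact: measurable_eball.
  move=> y yr i _; rewrite /I/= in_itv/=.
  have := le_lt_trans (ler_coord_enorm (y - x) i) yr.
  by rewrite !mxE ltr_norml => /andP[? ?]; apply/andP; split; lra.
have -> : B = [set y | forall i, I i (y ord0 i)].
  by apply/seteqP; split => y /= h i => [|_]; exact: h.
rewrite lebesgue_rV_box; last by move=> i; exact: measurable_itv.
under eq_bigr => i _.
  rewrite lebesgue_measure_itv/= lte_fin.
  rewrite (_ : (if _ then _ else _) = (2 * r)%:E); last first.
    have [r1|] := ltP; first by rewrite -EFinD; congr EFin; ring.
    by move=> ?; congr EFin; lra.
  over.
by rewrite prodEFin prodr_const card_ord.
Qed.

Lemma sum_geometric_le (q : R) n : 0 <= q < 1 -> \sum_(0 <= j < n) q ^+ j <= (1 - q)^-1.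
Proof.
move=> /andP[q0 q1]; rewrite -[leRHS]mul1r ler_pdivlMr ?subr_gt0//.
suff -> : (\sum_(0 <= j < n) q ^+ j) * (1 - q) = 1 - q ^+ n.
  by rewrite lerBlDr lerDl exprn_ge0.
elim: n => [|n IHn]; first by rewrite big_geq// expr0; ring.
by rewrite big_nat_recr//= mulrDl IHn exprS; ring.
Qed.

(** The least [n] with [s < 2^n r] is positive since [r <= s]. *)
Lemma dyadic_pick (r s : R) : 0 < r -> r <= s ->
  exists j : nat, 2 ^+ j * r <= s < 2 ^+ j.+1 * r.
Proof.
move=> r0 rs.
have [n hn] : exists n, s < 2 ^+ n * r.
  (* Archimedes, and [m < 2^m]. *)
  exists (Num.bound (s / r)); rewrite -ltr_pdivrMr//.
  apply: (@lt_le_trans _ _ (Num.bound (s / r))%:R).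
    by apply: le_lt_trans (archi_boundP _); rewrite ?divr_ge0 ?(le_trans (ltW r0)).
  by rewrite -natrX ler_nat ltnW// ltn_expl.
have /ex_minnP[[|m] sm mmin] : exists n, s < 2 ^+ n * r by exists n.
  by move: sm; rewrite expr0 mul1r ltNge rs.
exists m; rewrite sm andbT leNgt; apply/negP => /mmin.
by rewrite ltnn.
Qed.

(** On the shell [2^j r <= |y-x| < 2^(j+1) r] the weight is at most
    [(2^j r)^-c], and the integral of [g] over the shell is at most
    [A (2^(j+1) r)^b]; the products form a geometric series of ratio
    [2^(b-c) < 1]. *)
Lemma integral_tail_le (g : 'rV[R]_N -> R) x (A b c : R) :
  measurable_fun setT g -> (forall y, 0 <= g y) -> 0 <= A -> 0 <= c -> b < c ->
  (forall r, 0 < r -> (\int[L]_(y in eball x r) (g y)%:E <= (A * r `^ b)%:E)%E) ->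
  forall r, 0 < r ->
  (\int[L]_(y in ~` eball x r) (enorm (y - x) `^ (- c) * g y)%:E <=
    (A * (2 `^ b / (1 - 2 `^ (b - c))) * r `^ (b - c))%:E)%E.
Proof.
move=> mg g0 A0 c0 bc gb r r0.
pose f (j : nat) y : \bar R :=
  (((2 ^+ j * r) `^ (- c))%:E * ((\1_(eball x (2 ^+ j.+1 * r)) y * g y)%:E))%E.
have pr j : 0 < 2 ^+ j * r by rewrite mulr_gt0// exprn_gt0.
have f0 j y : (0 <= f j y)%E.
  by rewrite /f -EFinM lee_fin mulr_ge0 ?powR_ge0// mulr_ge0.
have mf j : measurable_fun setT (fun y => (\1_(eball x (2 ^+ j.+1 * r)) y * g y)%:E).
  apply/measurable_EFinP/measurable_funM => //.
  by apply: measurable_indic; exact: measurable_eball.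
apply: (@le_trans _ _ (\int[L]_(y in ~` eball x r) \sum_(0 <= j <oo) f j y)%E).
  apply: le_integral_ge0 => y /= yr; first by rewrite lee_fin mulr_ge0 ?powR_ge0.
  have [j /andP[j1 j2]] : exists j : nat, 2 ^+ j * r <= enorm (y - x) < 2 ^+ j.+1 * r.
    by apply: dyadic_pick => //; rewrite leNgt; exact/negP.
  apply: (@le_trans _ _ (f j y)).
    rewrite /f -EFinM lee_fin indicE mem_set// mul1r ler_wpM2r//.
    rewrite !powRN lef_pV2 ?posrE ?powR_gt0//; last exact: lt_le_trans j1.
    by apply: ge0_ler_powR; rewrite ?nnegrE ?enorm_ge0 ?(ltW (pr j)).
  rewrite (@nneseriesD1 _ (f ^~ y) j xpredT)//.
  rewrite leeDl//; apply: nneseries_ge0 => k _ _; exact: f0.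
apply: (@le_trans _ _ (\int[L]_y \sum_(0 <= j <oo) f j y)%E).
  rewrite integral_mkcond; apply: le_integral_ge0 => y _; rewrite /patch;
    case: ifPn => // _; exact: nneseries_ge0.
rewrite integral_nneseries//; last by move=> j; exact: measurable_funeM.
have q01 : 0 <= (2 : R) `^ (b - c) < 1.
  by rewrite powR_ge0 two_powR_lt1 ?subr_lt0.
set q : R := 2 `^ (b - c) in q01 *.
have fj j : (\int[L]_x f j x <= (A * 2 `^ b * r `^ (b - c) * q ^+ j)%:E)%E.
  rewrite /f ge0_integralZl//; last 2 first.
  - by move=> y _; rewrite lee_fin mulr_ge0.
  - by rewrite lee_fin powR_ge0.
  rewrite integral_mul_indic.
  apply: le_trans (lee_wpmul2l _ (gb _ (pr j.+1))) _; first by rewrite lee_fin powR_ge0.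
  rewrite -EFinM lee_fin exprS -mulrA (powRM b) ?(ltW (pr j))//.
  have -> : A * 2 `^ b * r `^ (b - c) * q ^+ j = A * 2 `^ b * (2 ^+ j * r) `^ (b - c).
    rewrite powRM ?exprn_ge0 ?ltW// -[2 ^+ j]powR_mulrn// -powRrM (mulrC j%:R) powRrM.
    by rewrite powR_mulrn ?powR_ge0//; ring.
  rewrite (powRD (r := b)) ?(gt_eqF (pr j)) ?implybT//.
  by rewrite le_eqVlt; apply/orP; left; apply/eqP; ring.
apply: lime_le; first by apply: is_cvg_nneseries => j _ _; exact: integral_ge0.
apply: nearW => n; apply: le_trans (lee_sum _ (fun j _ => fj j)) _.
rewrite sumEFin lee_fin -mulr_sumr.
have -> : A * (2 `^ b / (1 - q)) * r `^ (b - c) = A * 2 `^ b * r `^ (b - c) * (1 - q)^-1 by ring.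
by rewrite ler_wpM2l ?sum_geometric_le// !mulr_ge0 ?powR_ge0.
Qed.
End euclid.

(** * Finite differences *)

Section finite_difference.
Context {R : realType} {V : zmodType}.
Implicit Types (f g : V -> R) (h x : V).

(** Iterated forward differences [Delta_h^n f], over any abelian group, so that
    the same operator acts on functions of a vector and on their restrictions
    to a line. *)
Fixpoint fdiff n h f x : R :=
  if n is k.+1 then fdiff k h (fun y => f (y + h) - f y) x else f x.

Lemma fdiff_le n h f x (B : R) :
  (forall k, (k <= n)%N -> `|f (x + h *+ k)| <= B) ->
  `|fdiff n h f x| <= 2 ^+ n * B.
Proof.
elim: n f B => [|n IHn] f B fB /=.
  by rewrite expr0 mul1r; have := fB 0%N isT; rewrite mulr0n addr0.
rewrite exprSr -mulrA; apply: IHn => k kn; rewrite (le_trans (ler_normB _ _))//.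
rewrite mulrDl !mul1r lerD//; last by apply: fB; exact: leqW.
by rewrite -addrA -mulrSr; exact: fB.
Qed.

Lemma fdiffBr n h f x (c : R) :
  (0 < n)%N -> fdiff n h (fun y => f y - c) x = fdiff n h f x.
Proof.
case: n => // n _ /=; congr (fdiff n h _ x); apply/funext => y; ring.
Qed.

End finite_difference.

(** Differences commute with a map that intertwines the two translations, in
    particular with dilations and with the restriction to a line. *)
Lemma fdiff_comp {R : realType} {V W : zmodType} (n : nat) (h x : V) (a k : W)
    (f : V -> R) (g : W -> R) (u : W -> V) :
  (forall s, u (s + k) = u s + h) -> u a = x -> (forall s, f (u s) = g s) ->
  fdiff n h f x = fdiff n k g a.
Proof.
move=> uD ua; elim: n f g => [|n IHn] f g fg /=; first by rewrite -fg ua.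
by apply: IHn => s; rewrite -!fg uD.
Qed.

Section fdiff_derive.
Context {R : realType}.

(** The difference of order [n] is a mean of [h^n] times the derivative of order
    [n].  Induction: the derivative of order [n] of [f(s+h) - f(s)] is [h] times
    a value of the derivative of order [n+1], by the mean value theorem. *)
Lemma fdiff_le_derive n (f : nat -> R -> R) (a h B : R) : 0 < h ->
  (forall m s, (m < n)%N -> a <= s <= a + h *+ n ->
     is_derive s 1 (f m) (f m.+1 s)) ->
  (forall s, a <= s <= a + h *+ n -> `|f n s| <= B) ->
  `|fdiff n h (f 0%N) a| <= h ^+ n * B.
Proof.
move=> h0; elim: n f B => [|n IHn] f B df fB /=.
  by rewrite expr0 mul1r; apply: fB; rewrite mulr0n addr0 lexx.
have hn : h *+ n.+1 = h *+ n + h by rewrite mulrSr.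
rewrite exprSr -mulrA.
apply: (IHn (fun m s => f m (s + h) - f m s)) => [m s mn /andP[as1 sa]|s /andP[as1 sa]].
  have d1 : is_derive s 1 (f m) (f m.+1 s).
    by apply: df; [exact: leqW|apply/andP; split; lra].
  have d2 : is_derive (s + h) 1 (f m) (f m.+1 (s + h)).
    by apply: df; [exact: leqW|apply/andP; split; lra].
  have d3 : is_derive s 1 (fun s => s + h : R) 1.
    by apply: is_derive_eq; rewrite addr0.
  have := @is_derive1_comp _ (f m) (fun s => s + h) s _ _ d2 d3.
  rewrite mulr1 => d4; exact: is_deriveB.
have dn r : r \in `[s, s + h] -> is_derive r 1 (f n) (f n.+1 r).
  by rewrite in_itv/= => /andP[? ?]; apply: df => //; apply/andP; split; lra.
have sh : s <= s + h by rewrite lerDl ltW.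
have doo r : r \in `]s, s + h[ -> is_derive r 1 (f n) (f n.+1 r).
  by move=> rs; apply: dn; exact: subset_itv_oo_cc rs.
have cf : {within `[s, s + h], continuous (f n)}.
  by apply: derivable_within_continuous => r rs; have [] := dn r rs.
have [r rs ->] := MVT_segment sh doo cf.
rewrite addrAC subrr add0r normrM (gtr0_norm h0) mulrC ler_pM2l//.
by apply: fB; move: rs; rewrite in_itv/= => /andP[? ?]; apply/andP; split; lra.
Qed.

End fdiff_derive.

(** * Derivatives of the multiplier along a coordinate line *)

Section symbol.
Context {R : realType}.
Variables (mu : R).
Hypothesis mu0 : 0 < mu.
Implicit Types (b s : R) (m : nat).

(** Along a coordinate line [|xi|^2] becomes [rho = s^2 + b], and each derivative
    of order [m] of [exp(-rho^mu)] is a sum of terms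
    [c s^i rho^(j mu - (i+m)/2) exp(-rho^mu)], coded by the triple [(c, i, j)].
    Homogeneity ties the exponent of [rho] to the order [m], which is common to
    all the terms of one derivative and therefore a separate argument. *)
Definition term_val m b s (t : R * nat * nat) : R :=
  let: (c, i, j) := t in
  c * s ^+ i * (s ^+ 2 + b) `^ (j%:R * mu - (i + m)%:R / 2) *
  expR (- ((s ^+ 2 + b) `^ mu)).

(** The three terms differentiate [s^i], the power of [rho], and the exponential. *)
Definition term_der m (t : R * nat * nat) : seq (R * nat * nat) :=
  let: (c, i, j) := t in
  [:: (c * i%:R, i.-1, j); (c * (2 * j%:R * mu - (i + m)%:R), i.+1, j);
      (- (2 * mu * c), i.+1, j.+1)].

Definition terms_val m b s (l : seq (R * nat * nat)) : R :=
  \sum_(t <- l) term_val m b s t.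

Fixpoint deriv_terms m : seq (R * nat * nat) :=
  if m is k.+1 then flatten [seq term_der k t | t <- deriv_terms k]
  else [:: (1, 0%N, 0%N)].

Lemma is_derive_term m b s t : 0 < s ^+ 2 + b ->
  is_derive s 1 ((term_val m b) ^~ t) (terms_val m.+1 b s (term_der m t)).
Proof.
case: t => [[c i] j] r0.
have dr : is_derive s 1 (fun s => s ^+ 2 + b : R) (2 * s).
  apply: is_derive_eq; rewrite addr0 /= scaler1; ring.
set al := j%:R * mu - (i + m)%:R / 2.
pose rho s := s ^+ 2 + b.
have da : is_derive s 1 (fun s => rho s `^ al) (al * rho s `^ (al - 1) * (2 * s)).
  exact: (@is_derive1_comp _ (fun r => r `^ al) rho s _ _ (is_derive1_powR al r0) dr).
have dmu : is_derive s 1 (fun s => rho s `^ mu) (mu * rho s `^ (mu - 1) * (2 * s)).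
  exact: (@is_derive1_comp _ (fun r => r `^ mu) rho s _ _ (is_derive1_powR mu r0) dr).
have de : is_derive s 1 (fun s => expR (- rho s `^ mu))
    (expR (- rho s `^ mu) * - (mu * rho s `^ (mu - 1) * (2 * s))).
  exact: (@is_derive1_comp _ expR (fun s => - rho s `^ mu) s _ _
    (is_derive_expR _) (is_deriveN dmu)).
have di : is_derive s 1 (fun s => s ^+ i : R) (i%:R * s ^+ i.-1).
  have := @is_deriveX _ _ (id : R -> R) i s 1 1 (is_derive_id _ _).
  by rewrite exprfctE scaler1.
have := is_deriveM (is_deriveM (is_deriveM (is_derive_cst c s 1) di) da) de.
move=> H; apply: (is_derive_eq H) => {H da dmu de di}.
rewrite /terms_val !big_cons big_nil /= /term_val -/al.
rewrite -[s ^+ 2 + b]/(rho s) scaler0 !addr0 /=.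
rewrite -[(cst c * _ * _) s]/(c * s ^+ i * rho s `^ al).
rewrite -[(cst c * _) s]/(c * s ^+ i).
rewrite -![_ *: _]/(_ * _).
have -> : j%:R * mu - (i.+1 + m.+1)%:R / 2 = al - 1.
  by rewrite /al addSn addnS -!natr1; field.
have -> : j.+1%:R * mu - (i.+1 + m.+1)%:R / 2 = al + (mu - 1).
  by rewrite /al addSn addnS -!natr1; field.
rewrite (@powRD _ _ al (mu - 1)) ?(gt_eqF r0) ?implybT//.
have -> : c * (2 * j%:R * mu - (i + m)%:R) = 2 * al * c by rewrite /al; field.
have -> : c * i%:R * s ^+ i.-1 * rho s `^ (j%:R * mu - (i.-1 + m.+1)%:R / 2) =
    c * i%:R * s ^+ i.-1 * rho s `^ al.
  by case: (i) @al => [|k] al; rewrite ?mulr0 ?mul0r// /al addnS.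
rewrite exprS; ring.
Qed.

Lemma is_derive_terms_val m b s l : 0 < s ^+ 2 + b ->
  is_derive s 1 ((terms_val m b) ^~ l)
    (terms_val m.+1 b s (flatten [seq term_der m t | t <- l])).
Proof.
move=> r0; elim: l => [|t l IHl] /=.
  have -> : (fun s' => terms_val m b s' [::]) = cst 0.
    by apply/funext => s'; rewrite /terms_val big_nil.
  by rewrite /terms_val big_nil; exact: is_derive_cst.
rewrite {1}/terms_val; under eq_fun do rewrite big_cons.
rewrite /terms_val big_cat/=; apply: is_deriveD => //; exact: is_derive_term.
Qed.

(** For [r >= 1] a large integer power of [v = r^mu] dominates [r^a], and
    [v^k <= k! exp v]. *)
Lemma powR_expR_le (a : R) : 0 <= a -> exists2 C, 0 <= C &
  forall r, 0 < r -> r `^ a * expR (- r `^ mu) <= C.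
Proof.
(* [k + 1] is an integer exponent with [a <= mu (k + 1)]. *)
move=> a0; pose k := Num.bound (a / mu).
have ak : a <= mu * k.+1%:R.
  rewrite -ler_pdivrMl// mulrC -natr1 ler_wpDr// ltW// archi_boundP//.
  by rewrite divr_ge0// ltW.
exists (1 + k.+1`!%:R) => [|r r0]; first by rewrite addr_ge0.
have [r1|r1] := leP r 1.
  rewrite -[leLHS]mulr1 (@le_trans _ _ (1 * 1))//; last by rewrite mulr1 lerDl.
  rewrite mulr1 ler_pM ?mulr_ge0 ?expR_ge0 ?powR_ge0//.
    exact: powR_le1 (ltW r0) r1.
  by rewrite expR_le1 oppr_le0 powR_ge0.
set v := r `^ mu.
have v0 : 0 < v by exact: powR_gt0.
rewrite expRN ler_pdivrMr ?expR_gt0//.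
apply: (@le_trans _ _ (v ^+ k.+1)).
  by rewrite -powR_mulrn ?(ltW v0)// -powRrM ler_powR// ltW.
rewrite mulrDl mul1r ler_wpDl ?expR_ge0//.
rewrite -ler_pdivrMl ?ltr0n ?fact_gt0// mulrC.
apply: le_trans (expR_ge1Dxn k (ltW v0)); exact: ler_wpDl.
Qed.

End symbol.

Section symbol_bound.
Context {R : realType}.
Variables (mu del : R).
Hypotheses (mu0 : 0 < mu) (del0 : 0 < del) (delmu : del <= 2 * mu) (del1 : del < 1).

(** A term with [j > 0] carries a positive power of [rho^mu].  The function itself
    ([j = 0]) does not, but one differentiation leaves only such terms, apart
    from terms with coefficient [0]. *)
Definition decaying_term (t : R * nat * nat) := (t.1.1 == 0) || (0 < t.2)%N.

Lemma decaying_term_der m (l : seq (R * nat * nat)) : all decaying_term l ->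
  all decaying_term (flatten [seq term_der mu m t | t <- l]).
Proof.
elim: l => //= -[[c i] j] l IHl /andP[ht /IHl H].
rewrite all_cat H andbT /= /decaying_term /= orbT andbT.
by case/orP: ht => /= [/eqP ->|->]; rewrite ?mul0r ?eqxx// !orbT.
Qed.

Lemma decaying_deriv_terms m : (0 < m)%N -> all decaying_term (deriv_terms mu m).
Proof.
elim: m => // -[_ _|m IHm _]; last by apply: decaying_term_der; exact: IHm.
by rewrite /= /decaying_term/= orbT !mulr0 mul0r addn0 subr0 mulr0 eqxx.
Qed.

(** As [|s|^i <= rho^(i/2)], the term is at most [rho^(j mu - m/2) exp(-rho^mu)].
    With [j >= 1] and [del <= 2 mu] the power [rho^(j mu - del/2)] is absorbed by
    the exponential, near [0] as well as at infinity. *)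
Lemma term_val_le m t : decaying_term t -> exists2 C, 0 <= C &
  forall b s, 0 <= b -> 0 < s ^+ 2 + b ->
    `|term_val mu m b s t| <= C * (s ^+ 2 + b) `^ ((del - m%:R) / 2).
Proof.
case: t => [[c i] j] /orP[/= /eqP ->|/= j0].
  by exists 0 => // b s _ _; rewrite /term_val !mul0r normr0.
have a0 : 0 <= j%:R * mu - del / 2.
  have j1 : 1 <= j%:R :> R by rewrite ler1n.
  by move: (j%:R) j1 mu0 delmu => k k1 ? ?; nra.
have [C C0 hC] := powR_expR_le mu0 a0.
exists (`|c| * C) => [|b s b0 r0]; first by rewrite mulr_ge0.
set rho := s ^+ 2 + b in r0 *.
rewrite /term_val -/rho !normrM -!mulrA ler_wpM2l//.
rewrite (ger0_norm (expR_ge0 _)) (ger0_norm (powR_ge0 _ _)).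
have si : `|s ^+ i| <= rho `^ (i%:R / 2).
  rewrite mulrC powRrM powR12_sqrt ?(ltW r0)// powR_mulrn ?sqrtr_ge0// normrX.
  rewrite lerXn2r ?nnegrE ?sqrtr_ge0// -sqrtr_sqr; apply: ler_wsqrtr.
  by rewrite lerDl.
apply: (@le_trans _ _ (rho `^ (i%:R / 2) *
    (rho `^ (j%:R * mu - (i + m)%:R / 2) * expR (- rho `^ mu)))).
  by rewrite ler_wpM2r ?mulr_ge0 ?powR_ge0 ?expR_ge0.
rewrite mulrA -powRD ?(gt_eqF r0) ?implybT//.
have -> : i%:R / 2 + (j%:R * mu - (i + m)%:R / 2) =
    (del - m%:R) / 2 + (j%:R * mu - del / 2) by rewrite natrD; field.
rewrite powRD ?(gt_eqF r0) ?implybT//.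
by rewrite -mulrA (mulrC C) ler_wpM2l ?powR_ge0 ?hC.
Qed.

Lemma terms_val_le m l : all decaying_term l -> exists2 C, 0 <= C &
  forall b s, 0 <= b -> 0 < s ^+ 2 + b ->
    `|terms_val mu m b s l| <= C * (s ^+ 2 + b) `^ ((del - m%:R) / 2).
Proof.
elim: l => [_|t l IHl /andP[/term_val_le-/(_ m)[C C0 hC] /IHl[D D0 hD]]].
  by exists 0 => // b s _ _; rewrite /terms_val big_nil normr0 mul0r.
exists (C + D) => [|b s b0 r0]; first exact: addr_ge0.
rewrite /terms_val big_cons mulrDl (le_trans (ler_normD _ _))// lerD ?hC//.
exact: hD.
Qed.

End symbol_bound.

(** * Finite differences of the multiplier *)

Section multiplier.
Context {R : realType} {N : nat}.
Variables (mu del : R).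
Hypotheses (mu0 : 0 < mu) (del0 : 0 < del) (delmu : del <= 2 * mu) (del1 : del < 1).
Implicit Types (xi : 'rV[R]_N) (i : 'I_N).

(** The Fourier multiplier of the semigroup at time [1]; the one at time [t] is its
    composition with the dilation of ratio [t^(1/(2mu))]. *)
Definition heat_symbol xi : R := expR (- (enorm xi `^ (2 * mu))).

Definition axis i : 'rV[R]_N := delta_mx ord0 i.

Lemma enorm_powR xi a : enorm xi `^ (2 * a) = dotp xi xi `^ a.
Proof.
by rewrite /enorm -powR12_sqrt ?dotpp_ge0// -powRrM mulrA mulVf ?pnatr_eq0// mul1r.
Qed.

Lemma dotp_axis xi i (r : R) :
  dotp (xi + r *: axis i) (xi + r *: axis i) =
  (xi ord0 i + r) ^+ 2 + (dotp xi xi - xi ord0 i ^+ 2).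
Proof.
rewrite /dotp (bigD1 i)//= [in RHS](bigD1 i)//= !mxE !eqxx mulr1.
under eq_bigr => j ji do rewrite !mxE (negbTE ji) mulr0 addr0.
ring.
Qed.

Lemma dotp_axis0 xi i : 0 <= dotp xi xi - xi ord0 i ^+ 2.
Proof.
rewrite subr_ge0 -sqr_enorm -real_normK ?num_real//.
by rewrite ler_pXn2r ?nnegrE ?enorm_ge0// ler_coord_enorm.
Qed.

Lemma enorm_axis_le xi i (r : R) : 0 <= r ->
  enorm (xi + r *: axis i) <= enorm xi + r.
Proof.
move=> r0; rewrite -(ler_pXn2r (ltn0Sn 1)) ?nnegrE ?addr_ge0 ?enorm_ge0//.
rewrite sqr_enorm dotp_axis -sqr_enorm.
have := le_trans (ler_norm _) (ler_coord_enorm xi i).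
by set a := xi _ _; set e := enorm _ => ae; nra.
Qed.

Lemma enorm_axis_ge xi i (r : R) : 0 <= r <= enorm xi ->
  enorm xi - r <= enorm (xi + r *: axis i).
Proof.
move=> /andP[r0 rx]; rewrite -(ler_pXn2r (ltn0Sn 1)) ?nnegrE ?subr_ge0 ?enorm_ge0//.
rewrite sqr_enorm dotp_axis -sqr_enorm.
have := ler_coord_enorm xi i; rewrite ler_norml => /andP[+ _].
by set a := xi _ _; set e := enorm _ => ae; nra.
Qed.

(** For [|xi| <= 1], [1 - exp(-v) <= v = |xi|^(2mu) <= |xi|^del]; for [|xi| >= 1]
    the left-hand side is at most [1]. *)
Lemma heat_symbol_sub1_le xi : `|heat_symbol xi - 1| <= enorm xi `^ del.
Proof.
have [e0|e0] := eqVneq (enorm xi) 0.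
  rewrite /heat_symbol e0 powR0 ?mulf_neq0 ?pnatr_eq0 ?gt_eqF//.
  by rewrite oppr0 expR0 subrr normr0 powR_ge0.
have {}e0 : 0 < enorm xi by rewrite lt_neqAle eq_sym e0 enorm_ge0.
rewrite /heat_symbol distrC ger0_norm; last first.
  by rewrite subr_ge0 expR_le1 oppr_le0 powR_ge0.
have [e1|e1] := leP (enorm xi) 1; last first.
  by rewrite (le_trans _ (powR_ge1 (ltW del0) (ltW e1)))// gerBl expR_ge0.
apply: (@le_trans _ _ (enorm xi `^ (2 * mu))).
  (* [1 - exp(-v) <= v] *)
  by have := expR_ge1Dx (- enorm xi `^ (2 * mu)); lra.
by apply: ger_powR; rewrite ?e0.
Qed.

(** A difference of positive order annihilates constants, so the multiplier may be
    replaced by its difference with [1], which is small near the origin. *)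
Lemma fdiff_heat_symbol_near n xi i (h : R) : (0 < n)%N -> 0 <= h ->
  `|fdiff n (h *: axis i) heat_symbol xi| <= 2 ^+ n * (enorm xi + n%:R * h) `^ del.
Proof.
move=> n0 h0; rewrite -(fdiffBr _ _ _ 1 n0); apply: fdiff_le => k kn.
apply: (le_trans (heat_symbol_sub1_le _)).
apply: ge0_ler_powR; rewrite ?nnegrE ?addr_ge0 ?mulr_ge0 ?enorm_ge0 ?(ltW del0)//.
 rewrite scalerMnl -mulr_natl (le_trans (enorm_axis_le _ _ _))// ?mulr_ge0//.
by rewrite lerD2l ler_wpM2r// ler_nat.
Qed.

(** The segment from [xi] to [xi + n h e_i] stays at distance at least [|xi|/2]
    from the origin, where the derivative of order [n] is [O(|xi|^(del-n))]. *)
Lemma fdiff_heat_symbol_far n : (0 < n)%N -> exists2 C, 0 <= C &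
  forall xi i (h : R), 0 < h -> 2 * n%:R * h <= enorm xi ->
  `|fdiff n (h *: axis i) heat_symbol xi| <= C * h ^+ n * enorm xi `^ (del - n%:R).
Proof.
move=> n0.
have [C C0 hC] := terms_val_le mu0 delmu n (decaying_deriv_terms mu n0).
exists (C * 2 `^ (n%:R - del)) => [|xi i h h0 hx].
  by rewrite mulr_ge0 ?powR_ge0.
have x0 : 0 < enorm xi.
  by apply: lt_le_trans hx; rewrite !mulr_gt0// ltr0n.
pose b := dotp xi xi - xi ord0 i ^+ 2.
pose a := xi ord0 i.
have rhoE s : s ^+ 2 + b = enorm (xi + (s - a) *: axis i) ^+ 2.
  by rewrite sqr_enorm dotp_axis -/a -/b subrKC.
have rho_ge s : a <= s <= a + h *+ n -> (enorm xi / 2) ^+ 2 <= s ^+ 2 + b.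
  move=> /andP[as1 sa]; rewrite rhoE.
  rewrite ler_pXn2r ?nnegrE ?enorm_ge0 ?divr_ge0 ?enorm_ge0//.
  have hn : s - a <= enorm xi / 2.
    rewrite -[h *+ n]mulr_natl in sa.
    by rewrite ler_pdivlMr// (le_trans _ hx)//; lra.
  apply: (le_trans _ (enorm_axis_ge _ _)); first by lra.
  by apply/andP; split; lra.
have rho_gt s : a <= s <= a + h *+ n -> 0 < s ^+ 2 + b.
  by move=> /rho_ge; apply: lt_le_trans; rewrite exprn_gt0// divr_gt0.
rewrite (@fdiff_comp _ _ _ n (h *: axis i) xi a h heat_symbol
  (fun s => terms_val mu 0 b s (deriv_terms mu 0)) (fun s => xi + (s - a) *: axis i)).
- apply: le_trans (fdiff_le_derive (f := fun m s => terms_val mu m b s (deriv_terms mu m))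
    (B := C * (enorm xi / 2) `^ (del - n%:R)) h0 _ _) _.
  + by move=> m s mn sa; apply: is_derive_terms_val; exact: rho_gt.
  + move=> s sa; apply: le_trans (hC _ _ _ (rho_gt _ sa)) _.
      exact: dotp_axis0.
    rewrite ler_wpM2l//.
    have -> : (enorm xi / 2) `^ (del - n%:R) = ((enorm xi / 2) ^+ 2) `^ ((del - n%:R) / 2).
      rewrite -[_ ^+ 2]powR_mulrn ?divr_ge0 ?enorm_ge0// -powRrM.
      by congr (_ `^ _); field.
    apply: ler_powR_neg (rho_ge _ sa); last by rewrite exprn_gt0// divr_gt0.
    rewrite pmulr_lle0// subr_le0 (le_trans (ltW del1))// ler1n//.
  + rewrite (@powRM _ (enorm xi) 2^-1) ?enorm_ge0//.
    rewrite -[2^-1]powR_inv1// -powRrM mulN1r opprB.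
    by rewrite le_eqVlt; apply/orP; left; apply/eqP; ring.
- by move=> s; rewrite addrAC scalerDl addrA.
- by rewrite subrr scale0r addr0.
- move=> s; rewrite /heat_symbol enorm_powR dotp_axis -/a -/b subrKC.
  by rewrite /terms_val big_seq1 /= !(mul1r, mul0r, addn0, sub0r, oppr0, expr0, powRr0).
Qed.

End multiplier.

(** * Cosine transforms and tails of powers *)

Section fourier.
Context {R : realType} {N : nat}.
Implicit Types (x h xi : 'rV[R]_N) (f : 'rV[R]_N -> R).
Local Notation L := (@lebesgue_rV R N).

Lemma dotpDr x y z : @dotp R N x (y + z) = dotp x y + dotp x z.
Proof. by rewrite /dotp -big_split; apply: eq_bigr => i _; rewrite mxE mulrDr. Qed.

Lemma measurable_scaler_rV (T : R) : measurable_fun setT (fun x => T *: x).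
Proof.
apply: measurable_rVP => i; under eq_fun do rewrite mxE.
by apply: measurable_funM => //; exact: measurable_coord.
Qed.

Lemma measurable_fdiff n h f : measurable_fun setT f ->
  measurable_fun setT (fdiff n h f).
Proof.
elim: n f => // n IHn f mf; apply: IHn; apply: measurable_funB => //.
under eq_fun do rewrite addrC.
exact: measurableT_comp mf (measurable_addr_rV h).
Qed.

Lemma measurable_cos_dotp x : measurable_fun setT (fun xi => cos (dotp x xi)).
Proof.
apply: (@measurableT_comp _ _ _ _ _ _ (@cos R)).
  by apply: continuous_measurable_fun; exact: continuous_cos.
exact: measurable_dotp.
Qed.

(** As the shift by [h] changes the sign of the cosine,
    [\int (f(xi+h) - f(xi)) cos(x.xi) = -2 \int f cos(x.xi)]: passing to the
    difference doubles the absolute value. *)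
Lemma normr_Rintegral_cos_le n f x h :
  (forall xi, cos (dotp x (xi + h)) = - cos (dotp x xi)) ->
  L.-integrable setT (EFin \o f) ->
  (`|\int[L]_xi (f xi * cos (dotp x xi))|%:E <= \int[L]_xi `|fdiff n h f xi|%:E)%E.
Proof.
move=> cosN; elim: n f => [|n IHn] f fi.
  have /integrableP[/measurable_EFinP mf _] := fi.
  apply: le_Rintegral_abs => [|xi].
    by apply: measurable_funM => //; exact: measurable_cos_dotp.
  by rewrite normrM ler_piMr// ler_norml cos_geN1 cos_le1.
have /integrableP[/measurable_EFinP mf _] := fi.
pose g y := f (y + h).
have mg : measurable_fun setT g.
  rewrite /g; under eq_fun do rewrite addrC.
  exact: measurableT_comp mf (measurable_addr_rV h).
have gi : L.-integrable setT (EFin \o g).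
  apply/integrableP; split; first exact/measurable_EFinP.
  have /integrableP[_] := fi; congr (_ < _)%E.
  rewrite -(ge0_integral_addr h)//; last first.
    by apply: measurableT_comp => //; exact/measurable_EFinP.
  by apply: eq_integral => y _; rewrite /= /g addrC.
have icos u : L.-integrable setT (EFin \o u) ->
    L.-integrable setT (EFin \o (fun xi => u xi * cos (dotp x xi))).
  move=> ui; have /integrableP[/measurable_EFinP mu _] := ui.
  apply: le_integrable ui => //.
    by apply/measurable_EFinP/measurable_funM => //; exact: measurable_cos_dotp.
  move=> xi _; rewrite lee_fin normrM.
  by rewrite ler_piMr// ler_norml cos_geN1 cos_le1.
apply: le_trans (IHn _ (integrableB _ gi fi)) => //; rewrite lee_fin.
have -> : \int[L]_xi ((g xi - f xi) * cos (dotp x xi)) =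
    - 2 * \int[L]_xi (f xi * cos (dotp x xi)).
  under eq_Rintegral do rewrite mulrBl.
  rewrite RintegralB//; [|exact: icos|exact: icos].
  have -> : \int[L]_xi (g xi * cos (dotp x xi)) = - \int[L]_xi (f xi * cos (dotp x xi)).
    rewrite -[in RHS](Rintegral_addr h); last first.
      by apply: measurable_funM => //; exact: measurable_cos_dotp.
    under [in RHS]eq_Rintegral => xi _.
      rewrite (addrC h) cosN mulrN -mulN1r -/(g xi).
      over.
    by rewrite RintegralZl//; [ring|exact: icos].
  ring.
by rewrite normrM normrN ler_peMl// normr_nat ler1n.
Qed.

Lemma ge0_integral_eball_split f x (r : R) :
  measurable_fun setT f -> (forall xi, 0 <= f xi) ->
  (\int[L]_xi (f xi)%:E = \int[L]_(xi in eball x r) (f xi)%:E +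
     \int[L]_(xi in ~` eball x r) (f xi)%:E)%E.
Proof.
move=> mf f0; rewrite -ge0_integral_setU//.
- by rewrite setUv.
- exact: measurable_eball.
- by apply: measurableC; exact: measurable_eball.
- by apply/measurable_EFinP; rewrite setUv.
- by move=> y _; rewrite lee_fin.
- by rewrite disj_set2E setICr.
Qed.

Lemma integral_eball_cst x (r c : R) : 0 <= r -> 0 <= c ->
  (\int[L]_(xi in eball x r) c%:E <= (c * (2 * r) ^+ N)%:E)%E.
Proof.
move=> r0 c0; rewrite integral_cst; last exact: measurable_eball.
by rewrite EFinM lee_wpmul2l// ?lee_fin// lebesgue_eball.
Qed.

(** [integral_tail_le] for [g = 1], where the growth exponent is [N]. *)
Lemma integral_tail_powR (c : R) : N%:R < c -> exists2 C, 0 <= C &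
  forall x r, 0 < r ->
  (\int[L]_(y in ~` eball x r) (enorm (y - x) `^ (- c))%:E <=
    (C * r `^ (N%:R - c))%:E)%E.
Proof.
move=> Nc; exists (2 ^+ N * (2 `^ N%:R / (1 - 2 `^ (N%:R - c)))) => [|x r r0].
  rewrite mulr_ge0 ?exprn_ge0// divr_ge0 ?powR_ge0// subr_ge0 ltW//.
  by rewrite two_powR_lt1 ?subr_lt0.
have A0 : 0 <= 2 ^+ N :> R by exact: exprn_ge0.
have c0 : 0 <= c by exact: le_trans (ltW Nc).
have ball1 s : 0 < s ->
    (\int[L]_(y in eball x s) (cst (1 : R) y)%:E <= (2 ^+ N * s `^ N%:R)%:E)%E.
  move=> s0; apply: le_trans (integral_eball_cst x (ltW s0) ler01) _.
  by rewrite mul1r exprMn powR_mulrn// ltW.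
have := integral_tail_le (measurable_cst _) (fun=> ler01) A0 c0 Nc ball1 r0.
by under eq_integral do rewrite /= mulr1.
Qed.

End fourier.

(** * Pointwise bounds for the heat kernel *)

Section heat_kernel_bound.
Context {R : realType} {N : nat}.
Implicit Types (x h xi : 'rV[R]_N) (T : R).
Local Notation L := (@lebesgue_rV R N).
Variables (mu del : R).
Hypotheses (mu0 : 0 < mu) (del0 : 0 < del) (delmu : del <= 2 * mu) (del1 : del < 1).

Lemma heat_symbol_ge0 xi : 0 <= heat_symbol mu xi. Proof. exact: expR_ge0. Qed.

Lemma heat_symbol_le1 xi : heat_symbol mu xi <= 1.
Proof. by rewrite expR_le1 oppr_le0 powR_ge0. Qed.

Lemma measurable_heat_symbolZ T : measurable_fun setT (fun xi => heat_symbol mu (T *: xi)).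
Proof.
apply: (measurableT_comp (@measurable_expR R)).
apply: (@measurableT_comp _ _ _ _ _ _ (-%R : R -> R)) => //.
apply: (measurableT_comp (@measurable_powR R _)).
by apply: measurable_enorm; exact: measurable_scaler_rV.
Qed.

(** At most [1] on the ball of radius [1/T], and [O((T|xi|)^(-N-1))] outside. *)
Lemma integral_heat_symbol_le : exists2 C, 0 <= C & forall T, 0 < T ->
  (\int[L]_xi (heat_symbol mu (T *: xi))%:E <= (C * T `^ (- N%:R))%:E)%E.
Proof.
have mu20 : 0 < 2 * mu by rewrite mulr_gt0.
have [D D0 hD] := @powR_expR_le R (2 * mu) mu20 N.+1%:R (ler0n _ _).
have NS : N%:R < N.+1%:R :> R by rewrite ltr_nat.
have [E E0 hE] := integral_tail_powR (R := R) NS.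
exists (2 ^+ N + D * E) => [|T T0]; first by rewrite addr_ge0 ?mulr_ge0 ?exprn_ge0.
have T10 : 0 < T^-1 by rewrite invr_gt0.
rewrite (ge0_integral_eball_split 0 T^-1 (measurable_heat_symbolZ T) (fun xi => heat_symbol_ge0 _)).
rewrite mulrDl EFinD leeD//.
  apply: (@le_trans _ _ (\int[L]_(xi in eball 0 T^-1) 1%:E)%E).
    by apply: le_integral_ge0 => xi _; rewrite lee_fin ?heat_symbol_ge0 ?heat_symbol_le1.
  apply: le_trans (integral_eball_cst _ (ltW T10) ler01) _.
  by rewrite lee_fin mul1r exprMn exprVn powRN powR_mulrn// ltW.
apply: (@le_trans _ _ (\int[L]_(xi in ~` eball 0%R T^-1)
    ((D * T `^ (- N.+1%:R))%:E * (enorm (xi - 0) `^ (- N.+1%:R))%:E))%E).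
  apply: le_integral_ge0 => [xi _|xi /= /negP]; first by rewrite lee_fin heat_symbol_ge0.
  rewrite -leNgt subr0 => Txi.
  have xi0 : 0 < enorm xi by exact: lt_le_trans Txi.
  have := hD (T * enorm xi) (mulr_gt0 T0 xi0).
  rewrite -EFinM lee_fin /heat_symbol enormZ (gtr0_norm T0) -mulrA -powRM ?(ltW T0) ?(ltW xi0)//.
  rewrite (powRN (T * enorm xi) N.+1%:R) => h.
  by rewrite ler_pdivlMr ?powR_gt0 ?mulr_gt0// mulrC.
rewrite ge0_integralZl//.
- apply: le_trans (lee_wpmul2l _ (hE _ _ T10)) _.
    by rewrite lee_fin mulr_ge0 ?powR_ge0.
  rewrite -EFinM lee_fin le_eqVlt; apply/orP; left; apply/eqP.
  rewrite -[T^-1]powR_inv1 ?ltW// -powRrM mulN1r opprB.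
  have -> : T `^ (- N%:R) = T `^ (- N.+1%:R) * T `^ (N.+1%:R - N%:R).
    by rewrite -powRD ?(gt_eqF T0) ?implybT// addKr.
  ring.
- by apply: measurableC; exact: measurable_eball.
- apply/measurable_EFinP; apply: (measurableT_comp (@measurable_powR R _)) => //.
  apply: (measurable_funS measurableT) => //.
  by apply: measurable_enorm; exact: measurable_subr_rV.
- by move=> xi _; rewrite lee_fin powR_ge0.
- by rewrite lee_fin mulr_ge0 ?powR_ge0.
Qed.

Definition cos_transform T x : R := \int[L]_xi (heat_symbol mu (T *: xi) * cos (dotp x xi)).

Lemma cos_transform_le : exists2 C, 0 <= C & forall T x, 0 < T ->
  `|cos_transform T x| <= C * T `^ (- N%:R).
Proof.
have [C C0 hC] := integral_heat_symbol_le; exists C => // T x T0.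
rewrite -lee_fin; apply: le_trans (hC T T0); apply: le_Rintegral_abs => [|xi].
  by apply: measurable_funM; [exact: measurable_heat_symbolZ|exact: measurable_cos_dotp].
by rewrite normrM ger0_norm ?heat_symbol_ge0// ler_piMr ?heat_symbol_ge0// ler_norml cos_geN1 cos_le1.
Qed.

Lemma cos_axis x i xi : x ord0 i != 0 ->
  cos (dotp x (xi + (pi / `|x ord0 i|) *: axis i)) = - cos (dotp x xi).
Proof.
move=> xi0; rewrite dotpDr.
have -> : dotp x ((pi / `|x ord0 i|) *: axis i) = x ord0 i / `|x ord0 i| * pi.
  rewrite /dotp (bigD1 i)//= big1 => [|j ji]; rewrite !mxE ?eqxx ?(negbTE ji) ?mulr0//.
  by rewrite addr0 mulr1; ring.
have [xi_gt0|xi_le0] := ltP 0 (x ord0 i).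
  by rewrite gtr0_norm// divff// mul1r cosDpi.
rewrite ler0_norm// invrN mulrN divff// mulN1r.
by rewrite -[in RHS](subrK pi (dotp x xi)) cosDpi opprK.
Qed.

Let n := N.+1.

(** The order [n = N+1] is the least for which [|xi|^(del-n)] is integrable at
    infinity.  The ball of radius [2 n eta] contributes
    [T^del eta^del eta^N] by [fdiff_heat_symbol_near]; its complement contributes
    [T^del eta^n eta^(N-n+del)] by [fdiff_heat_symbol_far]. *)
Lemma integral_fdiff_heat_symbol_le : exists2 C, 0 <= C & forall T i (eta : R), 0 < T -> 0 < eta ->
  (\int[L]_xi `|fdiff n (eta *: axis i) (fun xi => heat_symbol mu (T *: xi)) xi|%:E <=
   (C * T `^ del * eta `^ (N%:R + del))%:E)%E.
Proof.
have n0 : 0 < n%:R :> R by rewrite ltr0n.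
(* [del < 1] is used here: [|xi|^(del-n)] decays faster than [|xi|^-N]. *)
have nN : n%:R = N%:R + 1 :> R by rewrite -natr1.
have Nc : N%:R < n%:R - del :> R by move: del1; rewrite nN => ?; lra.
have [E E0 hE] := integral_tail_powR (R := R) Nc.
have [D D0 hD] := @fdiff_heat_symbol_far R N _ _ mu0 delmu del1 n isT.
exists (2 ^+ n * (3 * n%:R) `^ del * (4 * n%:R) ^+ N +
    D * E * (2 * n%:R) `^ (N%:R - (n%:R - del))) => [|T i eta T0 e0].
  by rewrite addr_ge0 ?mulr_ge0 ?exprn_ge0 ?powR_ge0 ?(ltW n0).
pose r := 2 * n%:R * eta.
have r0 : 0 < r by rewrite !mulr_gt0.
have fdE xi : fdiff n (eta *: axis i) (fun xi => heat_symbol mu (T *: xi)) xi =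
    fdiff n ((T * eta) *: axis i) (heat_symbol mu) (T *: xi).
  apply/esym/(@fdiff_comp _ _ _ _ _ _ _ _ _ _ (fun y => T *: y)) => // s.
  by rewrite scalerDr scalerA.
have Te0 : 0 < T * eta by exact: mulr_gt0.
have mf : measurable_fun setT
    (fun xi => `|fdiff n (eta *: axis i) (fun xi => heat_symbol mu (T *: xi)) xi|).
  apply: measurableT_comp => //; apply: measurable_fdiff; exact: measurable_heat_symbolZ.
rewrite (ge0_integral_eball_split 0 r mf (fun=> normr_ge0 _)).
rewrite 2!mulrDl EFinD leeD//.
  apply: (@le_trans _ _ (\int[L]_(xi in eball 0%R r)
      (2 ^+ n * (3 * n%:R * (T * eta)) `^ del)%:E)%E).
    apply: le_integral_ge0 => xi; rewrite ?lee_fin ?normr_ge0//.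
    move=> xB; have xir : enorm xi < r by move: xB; rewrite /eball/= subr0.
    rewrite fdE (le_trans (fdiff_heat_symbol_near mu0 del0 delmu _ _ _ (ltW Te0)))//.
    rewrite ler_wpM2l ?exprn_ge0//; apply: ge0_ler_powR; rewrite ?nnegrE ?(ltW del0)//.
    - exact: addr_ge0 (enorm_ge0 _) (mulr_ge0 (ltW n0) (ltW Te0)).
    - exact: mulr_ge0 (mulr_ge0 _ (ltW n0)) (ltW Te0).
    rewrite enormZ gtr0_norm//.
    have := ler_wpM2l (ltW T0) (ltW xir); rewrite /r.
    by set a := T * enorm _ => ha; lra.
  apply: le_trans (integral_eball_cst _ (ltW r0) _) _.
    by rewrite mulr_ge0 ?exprn_ge0 ?powR_ge0.
  rewrite lee_fin le_eqVlt; apply/orP; left; apply/eqP.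
  have -> : 2 * r = 4 * n%:R * eta by rewrite /r; ring.
  rewrite (@powRM _ (3 * n%:R)) ?mulr_ge0 ?(ltW n0) ?(ltW e0) ?(ltW T0)//.
  rewrite (@powRM _ T) ?(ltW e0) ?(ltW T0)// (exprMn_comm _ (mulrC _ _)).
  rewrite powRD ?(gt_eqF e0) ?implybT// powR_mulrn ?(ltW e0)//; ring.
apply: (@le_trans _ _ (\int[L]_(xi in ~` eball 0%R r)
    ((D * (T * eta) ^+ n * T `^ (del - n%:R))%:E *
     (enorm (xi - 0) `^ (- (n%:R - del)))%:E))%E).
  apply: le_integral_ge0 => [xi _|xi xB]; first by rewrite lee_fin normr_ge0.
  have rxi : r <= enorm xi.
    by rewrite leNgt; apply/negP => xr; apply: xB; rewrite /eball/= subr0.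
  rewrite subr0 -EFinM lee_fin fdE.
  apply: le_trans (hD _ _ _ Te0 _) _.
    rewrite enormZ gtr0_norm// mulrCA ler_pM2l//.
  by rewrite enormZ gtr0_norm// powRM ?enorm_ge0 ?(ltW T0)// opprB mulrA.
rewrite ge0_integralZl//.
- apply: le_trans (lee_wpmul2l _ (hE _ _ r0)) _.
    by rewrite lee_fin !mulr_ge0 ?powR_ge0 ?exprn_ge0 ?(ltW Te0).
  rewrite -EFinM lee_fin le_eqVlt; apply/orP; left; apply/eqP.
  rewrite /r (@powRM _ (2 * n%:R)) ?mulr_ge0 ?(ltW n0) ?(ltW e0)//.
  rewrite exprMn -!powR_mulrn ?(ltW T0) ?(ltW e0)//.
  have -> : T `^ del = T `^ n%:R * T `^ (del - n%:R).
    by rewrite -powRD ?(gt_eqF T0) ?implybT// subrKC.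
  have -> : eta `^ (N%:R + del) = eta `^ n%:R * eta `^ (N%:R - (n%:R - del)).
    by rewrite -powRD ?(gt_eqF e0) ?implybT//; congr (_ `^ _); ring.
  ring.
- by apply: measurableC; exact: measurable_eball.
- apply/measurable_EFinP; apply: (measurableT_comp (@measurable_powR R _)) => //.
  apply: (measurable_funS measurableT) => //.
  by apply: measurable_enorm; exact: measurable_subr_rV.
- by move=> xi _; rewrite lee_fin powR_ge0.
- by rewrite lee_fin !mulr_ge0 ?powR_ge0 ?exprn_ge0 ?(ltW Te0).
Qed.

(** The step [pi/|x_i|] in the direction of the largest coordinate of [x] is
    comparable to [1/|x|]. *)
Lemma cos_transform_decay : exists2 C, 0 <= C & forall T x, 0 < T -> 0 < enorm x ->
  `|cos_transform T x| <= C * T `^ del * enorm x `^ (- (N%:R + del)).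
Proof.
have [C C0 hC] := integral_fdiff_heat_symbol_le; have [D D0 hD] := integral_heat_symbol_le.
exists (C * (pi * N%:R) `^ (N%:R + del)) => [|T x T0 x0].
  by rewrite mulr_ge0 ?powR_ge0.
have [i xi] := enorm_le_max_coord x0.
have xi0 : 0 < `|x ord0 i|.
  rewrite normr_gt0; apply/eqP => xi0; move: xi; rewrite xi0 normr0 mulr0.
  by rewrite leNgt x0.
have eta0 : 0 < pi / `|x ord0 i| by rewrite divr_gt0 ?pi_gt0.
rewrite -lee_fin; apply: le_trans (normr_Rintegral_cos_le n
  (h := (pi / `|x ord0 i|) *: axis i) _ _) _.
- by move=> y; apply: cos_axis; rewrite -normr_gt0.
- apply/integrableP; split; first by apply/measurable_EFinP; exact: measurable_heat_symbolZ.
  apply: le_lt_trans (ltry (D * T `^ (- N%:R))); apply: le_trans (hD _ T0).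
  by apply: le_integral_ge0 => y _; rewrite ?abse_ge0//= lee_fin ger0_norm ?heat_symbol_ge0.
apply: le_trans (hC _ _ _ T0 eta0) _; rewrite lee_fin.
have etax : pi / `|x ord0 i| <= pi * N%:R * (enorm x)^-1.
  by rewrite ler_pdivrMr// mulrAC ler_pdivlMr// -mulrA ler_pM2l ?pi_gt0.
set a := N%:R + del; have a0 : 0 <= a by rewrite addr_ge0// ltW.
have piN : 0 <= pi * N%:R :> R by rewrite mulr_ge0// ltW// pi_gt0.
have -> : enorm x `^ (- a) = (enorm x)^-1 `^ a.
  by rewrite -[_^-1]powR_inv1 ?enorm_ge0// -powRrM mulN1r.
have -> : C * (pi * N%:R) `^ a * T `^ del * (enorm x)^-1 `^ a =
    C * T `^ del * (pi * N%:R * (enorm x)^-1) `^ a.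
  by rewrite (@powRM _ (pi * N%:R)) ?invr_ge0 ?enorm_ge0//; ring.
rewrite ler_wpM2l ?mulr_ge0 ?powR_ge0//; apply: ge0_ler_powR => //.
  by rewrite nnegrE ltW.
by rewrite nnegrE mulr_ge0 ?invr_ge0 ?enorm_ge0.
Qed.

Lemma heat_kernelE t x : 0 < t -> heat_kernel mu t x =
  (2 * pi) ^- N * cos_transform (t `^ (2 * mu)^-1) x.
Proof.
move=> t0; rewrite /heat_kernel /heat_kernelC /=.
set I1 := \int[_]_y _; set I2 := \int[_]_y _.
rewrite mul0r subr0 {}/I1 {}/I2; congr (_ * _); apply: eq_Rintegral => y _.
rewrite !mul0r !mul1r !subr0 !add0r /heat_symbol enormZ ger0_norm ?powR_ge0//.
rewrite powRM ?powR_ge0 ?enorm_ge0// -powRrM mulVf ?mulf_neq0 ?pnatr_eq0 ?gt_eqF//.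
by rewrite powRr1 ?(ltW t0)// sub0r.
Qed.

Lemma measurable_heat_kernel t : 0 < t -> measurable_fun setT (heat_kernel mu t : 'rV[R]_N -> R).
Proof.
move=> t0; rewrite (funext (fun x => heat_kernelE x t0)).
apply: measurable_funM => //.
apply: (@measurable_Rintegral_param _ _ _ _ _ L
  (fun z => heat_symbol mu (t `^ (2 * mu)^-1 *: z.2) * cos (dotp z.1 z.2))).
apply: measurable_funM.
  exact: measurableT_comp (measurable_heat_symbolZ _) measurable_snd.
apply: (@measurableT_comp _ _ _ _ _ _ (@cos R)).
  by apply: continuous_measurable_fun; exact: continuous_cos.
exact: measurable_dotp.
Qed.

(** At [|x| = T] the two bounds agree; the second one improves on the borderline
    rate [|x|^-N] by the power [del], which makes the kernel integrable
    uniformly in time. *)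
Lemma heat_kernel_bounds : exists2 C, 0 <= C & forall t x, 0 < t ->
  `|heat_kernel mu t x| <= C * (t `^ (2 * mu)^-1) `^ (- N%:R) /\
  (0 < enorm x -> `|heat_kernel mu t x| <=
     C * (t `^ (2 * mu)^-1) `^ del * enorm x `^ (- (N%:R + del))).
Proof.
have [C C0 hC] := cos_transform_le; have [D D0 hD] := cos_transform_decay.
pose c : R := (2 * pi) ^- N.
have c0 : 0 <= c by rewrite invr_ge0 exprn_ge0// mulr_ge0// ltW// pi_gt0.
exists (c * (C + D)) => [|t x t0]; first by rewrite mulr_ge0 ?addr_ge0.
have T0 : 0 < t `^ (2 * mu)^-1 by exact: powR_gt0.
rewrite heat_kernelE// normrM (ger0_norm c0) -!(mulrA c).
split => [|x0]; rewrite ler_wpM2l//.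
  by rewrite (le_trans (hC _ x T0))// ler_wpM2r ?powR_ge0// lerDl.
apply: le_trans (hD _ x T0 x0) _; rewrite -!mulrA ler_wpM2r ?mulr_ge0 ?powR_ge0//.
by rewrite lerDr.
Qed.

End heat_kernel_bound.

(** * Morrey norms as growth bounds on balls *)

Section morrey_bound.
Context {R : realType} {N : nat}.
Implicit Types (x : 'rV[R]_N) (f g : 'rV[R]_N -> R) (p q l s r A B : R).
Local Notation L := (@lebesgue_rV R N).

(** This is the [p]-th power of the inequality between the norm of [M^{p,l}] and
    [A]; see [morrey_bound_norm] and [morrey_norm_bound]. *)
Definition morrey_bound p l A f := forall x r, 0 < r ->
  (\int[L]_(y in eball x r) (`|f y| `^ p)%:E <= (A `^ p * r `^ (N%:R - l))%:E)%E.

Lemma measurable_norm_powR p f (D : set 'rV[R]_N) : measurable_fun setT f ->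
  measurable_fun D (fun y => (`|f y| `^ p)%:E).
Proof.
move=> mf; apply: (measurable_funS measurableT) => //.
apply/measurable_EFinP; apply: (measurableT_comp (@measurable_powR R _)).
exact: measurableT_comp.
Qed.

Lemma integral_norm_powR_ge0 p f (D : set 'rV[R]_N) :
  (0 <= \int[L]_(y in D) (`|f y| `^ p)%:E)%E.
Proof. by apply: integral_ge0 => y _; rewrite lee_fin powR_ge0. Qed.

Lemma Lnorm_restrict p f (D : set 'rV[R]_N) : 0 < p ->
  ('N[L]_(p%:E)[EFin \o (\1_D \* f)%R] =
   (\int[L]_(y in D) (`|f y| `^ p)%:E) `^ p^-1)%E.
Proof.
move=> p0; rewrite Lnorm.unlock.
suff -> : (\int[L]_x (`|(EFin \o (\1_D \* f)%R) x| `^ p) =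
  \int[L]_(y in D) (`|f y| `^ p)%:E)%E by [].
rewrite [RHS]integral_mkcond; apply: eq_integral => y _ /=.
rewrite /patch indicE; case: ifP => _; first by rewrite mul1r.
by rewrite mul0r normr0 powR0// gt_eqF.
Qed.

Lemma morrey_bound_norm p l A f : 0 < p -> 0 <= A ->
  morrey_bound p l A f -> (morrey_norm p%:E l f <= A%:E)%E.
Proof.
move=> p0 A0 fA; apply: ge_ereal_sup => _ [x _ [r /= r0 <-]].
rewrite Lnorm_restrict//.
apply: (@le_trans _ _ ((r `^ ((l - N%:R) / p))%:E *
    ((A `^ p * r `^ (N%:R - l))%:E `^ p^-1))%E).
  rewrite lee_wpmul2l ?lee_fin ?powR_ge0//.
  apply: gt0_ler_poweR; first by rewrite invr_ge0 ltW.
  - by rewrite in_itv/= leey andbT integral_norm_powR_ge0.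
  - by rewrite in_itv/= leey andbT lee_fin mulr_ge0 ?powR_ge0.
  - exact: fA.
rewrite poweR_EFin -EFinM lee_fin powRM ?powR_ge0// -!powRrM mulfV ?gt_eqF// powRr1//.
rewrite mulrCA -powRD ?(gt_eqF r0) ?implybT//.
by rewrite -mulrDl addrA subrK subrr mul0r powRr0 mulr1.
Qed.

Lemma morrey_norm_bound p l A f : 0 < p -> 0 <= A ->
  (morrey_norm p%:E l f <= A%:E)%E -> morrey_bound p l A f.
Proof.
move=> p0 A0 fA x r r0.
set I := integral _ _ _.
have I0 : (0 <= I)%E by exact: integral_norm_powR_ge0.
have : ((r `^ ((l - N%:R) / p))%:E * I `^ p^-1 <= A%:E)%E.
  apply: le_trans fA; apply: ereal_sup_ubound; exists x => //; exists r => //.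
  by rewrite Lnorm_restrict.
have c0 : 0 < r `^ ((l - N%:R) / p) by exact: powR_gt0.
rewrite -lee_pdivlMl// -EFinM => h.
have {}h : (I `^ p^-1 `^ p <= ((r `^ ((l - N%:R) / p))^-1 * A)%:E `^ p)%E.
  apply: gt0_ler_poweR => //; first exact: ltW.
  - by rewrite in_itv/= leey andbT poweR_ge0.
  - by rewrite in_itv/= leey andbT lee_fin mulr_ge0// invr_ge0 ltW.
move: h; rewrite -poweRrM mulVf ?gt_eqF// poweRe1// poweR_EFin => /le_trans; apply.
rewrite lee_fin powRM ?invr_ge0 ?(ltW c0)// -powRN -powRrM mulNr divfK ?gt_eqF//.
by rewrite opprB mulrC.
Qed.

Lemma morrey_norm_ge0 p l f : (0 <= morrey_norm p%:E l f)%E.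
Proof.
apply: le_trans (ereal_sup_ubound _); last by exists 0 => //; exists 1 => //=; exact: ltr01.
by rewrite mule_ge0 ?lee_fin ?powR_ge0 ?Lnorm_ge0.
Qed.

Lemma in_morrey_bound p l f : 0 < p -> in_morrey p%:E l f ->
  measurable_fun setT f /\ exists2 A, 0 < A & morrey_bound p l A f.
Proof.
move=> p0 [[mf _] foo]; split=> //.
have n0 : (0 <= morrey_norm p%:E l f)%E by exact: morrey_norm_ge0.
exists (fine (morrey_norm p%:E l f) + 1).
  by rewrite ltr_wpDl// fine_ge0.
apply: morrey_norm_bound => //; first by rewrite addr_ge0// fine_ge0.
by rewrite EFinD fineK ?ge0_fin_numE// leeDl.
Qed.

(** A compact set is bounded, hence contained in a ball. *)
Lemma morrey_bound_in p l A f : 0 < p -> 0 <= A -> measurable_fun setT f ->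
  morrey_bound p l A f -> in_morrey p%:E l f.
Proof.
move=> p0 A0 mf fA; split; last first.
  exact: le_lt_trans (morrey_bound_norm p0 A0 fA) (ltry _).
split=> // K /compact_bounded[M [_ /(_ (`|M| + 1))]].
rewrite (le_lt_trans (ler_norm _)) ?ltrDl// => /(_ isT) KM.
rewrite Lnorm_restrict//.
pose r := N%:R * (`|M| + 1) + 1.
have M0 : 0 <= `|M| + 1 by rewrite addr_ge0.
have r0 : 0 < r by rewrite ltr_wpDl// mulr_ge0.
have KB : K `<=` eball 0 r.
  move=> y /KM yM; rewrite /eball/= subr0.
  apply: (@le_lt_trans _ _ (N%:R * (`|M| + 1))); last by rewrite ltrDl.
  apply: enorm_le_coord => // i; apply: le_trans yM.
  rewrite [leRHS]mx_normrE; exact: (le_bigmax _ (fun i => `|y i.1 i.2|) (ord0, i)).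
have : (\int[L]_(y in K) (`|f y| `^ p)%:E < +oo)%E.
  apply: le_lt_trans (ltry (A `^ p * r `^ (N%:R - l))).
  apply: le_trans (fA 0 r r0).
  rewrite integral_mkcond [leRHS]integral_mkcond; apply: le_integral_ge0 => y _.
    by rewrite /patch; case: ifP => _; rewrite lee_fin ?powR_ge0.
  rewrite /patch; case: ifPn => [/set_mem/KB/mem_set ->//|_].
  by case: ifP => _; rewrite lee_fin ?powR_ge0.
have := @integral_norm_powR_ge0 p f K.
case: (integral _ _ _) => // c _ _.
by rewrite poweR_EFin ltry.
Qed.

End morrey_bound.

(** * Inclusion, interpolation and sums of growth bounds *)

Section morrey_bound_ops.
Context {R : realType} {N : nat}.
Implicit Types (x : 'rV[R]_N) (f g : 'rV[R]_N -> R) (p q l s r A B D : R).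
Local Notation L := (@lebesgue_rV R N).

Lemma morrey_boundW p l A B f : 0 <= p -> 0 <= A -> A <= B ->
  morrey_bound p l A f -> morrey_bound p l B f.
Proof.
move=> p0 A0 AB fA x r r0; apply: le_trans (fA x r r0) _.
rewrite lee_fin ler_wpM2r ?powR_ge0//; apply: ge0_ler_powR; rewrite ?nnegrE//.
exact: le_trans AB.
Qed.

(** Take [la = A r^(-l/p)] in [powR_young], the value at which the two terms
    contribute equally to the integral over a ball of radius [r]. *)
Lemma morrey_bound_embed p q l A f : 1 <= q -> q <= p -> 0 < A ->
  measurable_fun setT f ->
  morrey_bound p l A f -> morrey_bound q (l * q / p) ((2 ^+ N + 1) * A) f.
Proof.
move=> q1 qp A0 mf fA x r r0.
have q0 : 0 <= q by exact: le_trans q1.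
have p0 : 0 < p by apply: lt_le_trans qp; exact: lt_le_trans q1.
pose la := A * r `^ (- (l / p)).
have la0 : 0 < la by rewrite mulr_gt0 ?powR_gt0.
apply: (@le_trans _ _ (\int[L]_(y in eball x r)
    ((la `^ q)%:E + (la `^ (q - p))%:E * (`|f y| `^ p)%:E))%E).
  apply: le_integral_ge0 => y _; first by rewrite lee_fin powR_ge0.
  by rewrite -EFinM -EFinD lee_fin powR_young.
have mB := measurable_eball x r.
rewrite ge0_integralD//; last 3 first.
- by move=> y _; rewrite lee_fin powR_ge0.
- by move=> y _; rewrite mule_ge0 ?lee_fin ?powR_ge0.
- by apply: emeasurable_funM => //; exact: measurable_norm_powR.
rewrite ge0_integralZl//; last 2 first.
- exact: measurable_norm_powR.
- by rewrite lee_fin powR_ge0.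
apply: le_trans (leeD (integral_eball_cst x (ltW r0) (powR_ge0 la q))
  (lee_wpmul2l _ (fA x r r0))) _; first by rewrite lee_fin powR_ge0.
rewrite -EFinM -EFinD lee_fin.
have rpos a b : r `^ (a + b) = r `^ a * r `^ b.
  by rewrite powRD ?(gt_eqF r0) ?implybT.
have laE a : la `^ a = A `^ a * r `^ (- (l / p) * a).
  by rewrite /la powRM ?powR_ge0 ?(ltW A0)// -powRrM.
have -> : la `^ q * (2 * r) ^+ N = 2 ^+ N * (A `^ q * r `^ (N%:R - l * q / p)).
  rewrite laE exprMn -(powR_mulrn _ (ltW r0)).
  have -> : N%:R - l * q / p = - (l / p) * q + N%:R by ring.
  rewrite rpos; ring.
have -> : la `^ (q - p) * (A `^ p * r `^ (N%:R - l)) =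
    A `^ q * r `^ (N%:R - l * q / p).
  rewrite laE mulrACA -powRD ?(gt_eqF A0) ?implybT// subrK -rpos.
  by congr (_ * _ `^ _); field; rewrite gt_eqF.
rewrite -[X in _ + X]mul1r -mulrDl powRM ?addr_ge0 ?exprn_ge0 ?(ltW A0)//.
rewrite mulrA ler_wpM2r ?powR_ge0// ler_wpM2r ?powR_ge0// le1r_powR//.
by rewrite lerDr exprn_ge0.
Qed.

(** [|f|^q <= D^(q-p) |f|^p]. *)
Lemma morrey_bound_interp p q l A D f : 0 < p -> p <= q -> 0 <= A -> 0 <= D ->
  measurable_fun setT f -> (forall x, `|f x| <= D) ->
  morrey_bound p l A f ->
  morrey_bound q l (D `^ (1 - p / q) * A `^ (p / q)) f.
Proof.
move=> p0 pq A0 D0 mf fD fA x r r0.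
have q0 : 0 < q by exact: lt_le_trans pq.
have mB := measurable_eball x r.
apply: (@le_trans _ _ (\int[L]_(y in eball x r)
    ((D `^ (q - p))%:E * (`|f y| `^ p)%:E))%E).
  apply: le_integral_ge0 => y _; first by rewrite lee_fin powR_ge0.
  rewrite -EFinM lee_fin; have [->|fy0] := eqVneq (f y) 0.
    by rewrite normr0 powR0 ?gt_eqF// mulr_ge0 ?powR_ge0.
  rewrite -[q in leLHS](subrK p) (@powRD _ `|f y| (q - p)) ?normr_eq0 ?(negbTE fy0) ?implybT//.
  rewrite ler_wpM2r ?powR_ge0//; apply: ge0_ler_powR; rewrite ?nnegrE//.
  by rewrite subr_ge0.
rewrite ge0_integralZl//; last 2 first.
- exact: measurable_norm_powR.
- by rewrite lee_fin powR_ge0.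
apply: le_trans (lee_wpmul2l _ (fA x r r0)) _; first by rewrite lee_fin powR_ge0.
rewrite -EFinM lee_fin mulrA ler_wpM2r ?powR_ge0//.
rewrite powRM ?powR_ge0// -!powRrM.
have -> : (1 - p / q) * q = q - p by field; rewrite gt_eqF.
by have -> : p / q * q = p by field; rewrite gt_eqF.
Qed.

Lemma morrey_boundD p l A B f g : 1 <= p -> 0 <= A -> 0 <= B ->
  measurable_fun setT f -> measurable_fun setT g ->
  morrey_bound p l A f -> morrey_bound p l B g ->
  morrey_bound p l (4 * (A + B)) (f \+ g).
Proof.
move=> p1 A0 B0 mf mg fA gB x r r0.
have p0 : 0 <= p by exact: le_trans p1.
have mE := measurable_eball x r.
apply: (@le_trans _ _ (\int[L]_(y in eball x r)
    ((2 `^ p)%:E * ((`|f y| `^ p)%:E + (`|g y| `^ p)%:E)))%E).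
  apply: le_integral_ge0 => y _; first by rewrite lee_fin powR_ge0.
  rewrite -EFinD -EFinM lee_fin (le_trans _ (powRD_le _ _ _))//.
  by apply: ge0_ler_powR; rewrite ?nnegrE ?addr_ge0// ler_normD.
rewrite ge0_integralZl//; last 2 first.
- by apply: emeasurable_funD; exact: measurable_norm_powR.
- by move=> y _; rewrite adde_ge0 ?lee_fin ?powR_ge0.
rewrite ge0_integralD//; last 2 first.
- exact: measurable_norm_powR.
- exact: measurable_norm_powR.
apply: le_trans (lee_wpmul2l _ (leeD (fA x r r0) (gB x r r0))) _.
  by rewrite lee_fin powR_ge0.
rewrite -EFinD -EFinM lee_fin -mulrDl mulrA ler_wpM2r ?powR_ge0//.
have -> : 4 * (A + B) = 2 * (2 * (A + B)) by ring.
rewrite powRM ?mulr_ge0 ?addr_ge0// ler_wpM2l ?powR_ge0//.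
rewrite powRM ?addr_ge0//.
apply: (@le_trans _ _ (2 * (A + B) `^ p)); last first.
  by rewrite ler_wpM2r ?powR_ge0// le1r_powR// ler1n.
rewrite mulrDl mul1r lerD//; apply: ge0_ler_powR; rewrite ?nnegrE ?addr_ge0//.
  by rewrite lerDl.
by rewrite lerDr.
Qed.

End morrey_bound_ops.

(** * The semigroup on functions of controlled growth *)

Section heat_semigroup_bound.
Context {R : realType} {N : nat}.
Implicit Types (x y z : 'rV[R]_N) (f g : 'rV[R]_N -> R) (p q l s r t A B : R).
Local Notation L := (@lebesgue_rV R N).
Variables (mu : R).
Hypothesis mu01 : 0 < mu <= 1.

Let mu0 : 0 < mu. Proof. by case/andP: mu01. Qed.

Let del : R := mu / 2.
Let del0 : 0 < del. Proof. by rewrite divr_gt0. Qed.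
Let delmu : del <= 2 * mu.
Proof. by move: mu0; rewrite /del => ?; lra. Qed.
Let del1 : del < 1.
Proof. by case/andP: mu01; rewrite /del => ? ?; lra. Qed.

(** The length [T] at which the kernel concentrates at time [t]. *)
Definition heat_scale t := t `^ (2 * mu)^-1.
Local Notation k := (@heat_kernel R N mu).

Lemma heat_scale_gt0 t : 0 < t -> 0 < heat_scale t.
Proof. exact: powR_gt0. Qed.

Lemma measurable_heat_kernel_subr t x : 0 < t ->
  measurable_fun setT (fun y => k t (x - y)).
Proof.
move=> t0; apply: (@measurableT_comp _ _ _ _ _ _ (k t) _ (fun y => x - y)).
  exact: measurable_heat_kernel.
exact: measurableT_comp (measurable_addr_rV x) (@measurable_oppr_rV R N).
Qed.

(** Inside the ball of radius [T] the kernel is [O(T^-N)]; outside, the decay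
    [|x-y|^-(N+del)] beats the growth exponent [b <= N] and [integral_tail_le]
    applies. *)
Lemma integral_heat_kernel_mul_le (b : R) : b <= N%:R -> exists2 K, 0 <= K &
  forall t g B, 0 < t -> measurable_fun setT g -> (forall y, 0 <= g y) -> 0 <= B ->
  (forall x r, 0 < r -> (\int[L]_(y in eball x r) (g y)%:E <= (B * r `^ b)%:E)%E) ->
  forall x, (\int[L]_y (`|k t (x - y)| * g y)%:E <=
    (K * B * heat_scale t `^ (b - N%:R))%:E)%E.
Proof.
move=> bN; have [C C0 hC] := @heat_kernel_bounds R N mu del mu0 del0 delmu del1.
pose c := N%:R + del; have bc : b < c by rewrite /c; move: del0 => ?; lra.
have c0 : 0 <= c by rewrite addr_ge0// ltW.
pose K1 : R := 2 `^ b / (1 - 2 `^ (b - c)).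
have K10 : 0 <= K1.
  rewrite divr_ge0 ?powR_ge0// subr_ge0 ltW//.
  by rewrite two_powR_lt1 ?subr_lt0.
exists (C * (1 + K1)) => [|t g B t0 mg g0 B0 gB x]; first by rewrite mulr_ge0 ?addr_ge0.
set T := heat_scale t; have T0 : 0 < T by exact: heat_scale_gt0.
have mk := measurable_heat_kernel_subr x t0.
have mF : measurable_fun setT (fun y => `|k t (x - y)| * g y).
  by apply: measurable_funM => //; exact: measurableT_comp.
have kg0 y : 0 <= `|k t (x - y)| * g y by rewrite mulr_ge0.
rewrite (ge0_integral_eball_split x T mF kg0).
have -> : C * (1 + K1) * B * T `^ (b - N%:R) =
    C * T `^ (- N%:R) * (B * T `^ b) +
    C * T `^ del * (B * K1 * T `^ (b - c)).
  have Tp a a' : T `^ (a + a') = T `^ a * T `^ a'.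
    by rewrite powRD ?(gt_eqF T0) ?implybT.
  have -> : T `^ (b - c) = T `^ (b - N%:R) * T `^ (- del).
    by rewrite -Tp; congr (_ `^ _); rewrite /c; ring.
  transitivity (C * B * (T `^ (- N%:R) * T `^ b) +
      C * B * K1 * T `^ (b - N%:R) * (T `^ del * T `^ (- del))); last by ring.
  by rewrite -!Tp subrr powRr0 (addrC (- _)); ring.
rewrite EFinD leeD//.
  apply: (@le_trans _ _ (\int[L]_(y in eball x T) ((C * T `^ (- N%:R))%:E * (g y)%:E))%E).
    apply: le_integral_ge0 => y _; first by rewrite lee_fin.
    by rewrite -EFinM lee_fin ler_wpM2r//; case: (hC t (x - y) t0).
  rewrite ge0_integralZl//; last 4 first.
  - exact: measurable_eball.
  - by apply/measurable_EFinP; exact: (measurable_funS measurableT).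
  - by move=> y _; rewrite lee_fin.
  - by rewrite lee_fin mulr_ge0 ?powR_ge0.
  apply: le_trans (lee_wpmul2l _ (gB x T T0)) _; last by rewrite -EFinM.
  by rewrite lee_fin mulr_ge0 ?powR_ge0.
apply: (@le_trans _ _ (\int[L]_(y in ~` eball x T)
    ((C * T `^ del)%:E * (enorm (y - x) `^ (- c) * g y)%:E))%E).
  apply: le_integral_ge0 => y yT; first by rewrite lee_fin.
  rewrite -EFinM lee_fin mulrA ler_wpM2r//.
  have xy : enorm (x - y) = enorm (y - x) by rewrite -enormN opprB.
  have xy0 : 0 < enorm (x - y).
    by rewrite xy (lt_le_trans T0)// leNgt; exact/negP.
  by have [_ /(_ xy0)] := hC t (x - y) t0; rewrite xy.
rewrite ge0_integralZl//.
- apply: le_trans (lee_wpmul2l _ (integral_tail_le mg g0 B0 c0 bc (gB x) T0)) _.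
    by rewrite lee_fin mulr_ge0 ?powR_ge0.
  by rewrite -EFinM.
- by apply: measurableC; exact: measurable_eball.
- apply/measurable_EFinP; apply: (measurable_funS measurableT) => //.
  apply: measurable_funM => //; apply: (measurableT_comp (@measurable_powR R _)).
  by apply: measurable_enorm; exact: measurable_subr_rV.
- by move=> y _; rewrite lee_fin mulr_ge0 ?powR_ge0.
- by rewrite lee_fin mulr_ge0 ?powR_ge0.
Qed.

(** [M^{p,l}] is included in [M^{1,l/p}], so [|f|] has growth exponent [N - l/p]. *)
Lemma integral_heat_kernel_morrey_le p l : 1 <= p -> 0 <= l -> exists2 K, 0 <= K &
  forall t f A x, 0 < t -> measurable_fun setT f -> 0 < A -> morrey_bound p l A f ->
  (\int[L]_y (`|k t (x - y)| * `|f y|)%:E <= (K * A * heat_scale t `^ (- (l / p)))%:E)%E.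
Proof.
move=> p1 l0; have p0 : 0 < p by exact: lt_le_trans p1.
have bN : N%:R - l / p <= N%:R by rewrite gerBl divr_ge0// ltW.
have [K K0 hK] := integral_heat_kernel_mul_le bN.
pose C : R := 2 ^+ N + 1.
have C0 : 0 < C by rewrite ltr_wpDl// exprn_ge0.
exists (K * C) => [|t f A x t0 mf A0 fA]; first by rewrite mulr_ge0// ltW.
have := hK t (fun y => `|f y|) (C * A) t0 _ _ _ _ x.
have -> : N%:R - l / p - N%:R = - (l / p) by ring.
rewrite mulrA; apply => //; first exact: measurableT_comp.
  by rewrite mulr_ge0 ?(ltW C0) ?(ltW A0).
move=> {}x r r0; have := morrey_bound_embed (lexx 1) p1 A0 mf fA x r0.
rewrite powRr1 ?mulr_ge0 ?(ltW C0) ?(ltW A0)// mulr1.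
by under eq_integral do rewrite powRr1//.
Qed.

Lemma integral_heat_kernel_abs_le : exists2 K, 0 <= K & forall t x, 0 < t ->
  (\int[L]_y `|k t (x - y)|%:E <= K%:E)%E.
Proof.
have [K K0 hK] := integral_heat_kernel_mul_le (lexx N%:R).
exists (K * 2 ^+ N) => [|t x t0]; first by rewrite mulr_ge0 ?exprn_ge0.
have := hK t (cst 1) (2 ^+ N) t0 (measurable_cst _) (fun=> ler01)
  (exprn_ge0 _ (ler0n _ _)) _ x.
under eq_integral do rewrite mulr1.
rewrite subrr powRr0 mulr1; apply => {}x r r0.
apply: le_trans (integral_eball_cst x (ltW r0) ler01) _.
by rewrite mul1r exprMn powR_mulrn// ltW.
Qed.

Lemma measurable_heat_semigroup t f : 0 < t -> measurable_fun setT f ->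
  measurable_fun setT (heat_semigroup mu t f).
Proof.
move=> t0 mf.
apply: (@measurable_Rintegral_param _ _ _ _ _ L
  (fun z : 'rV[R]_N * 'rV[R]_N => k t (z.1 - z.2) * f z.2)).
apply: measurable_funM; last exact: measurableT_comp mf measurable_snd.
apply: (@measurableT_comp _ _ _ _ _ _ (k t) _
    (fun z : 'rV[R]_N * 'rV[R]_N => z.1 - z.2)).
  exact: measurable_heat_kernel.
exact: measurable_sub_rV.
Qed.

Lemma heat_semigroup_abs_le t f x : 0 < t -> measurable_fun setT f ->
  (`|heat_semigroup mu t f x|%:E <= \int[L]_y (`|k t (x - y)| * `|f y|)%:E)%E.
Proof.
move=> t0 mf; apply: le_Rintegral_abs => [|y]; last by rewrite normrM.
by apply: measurable_funM => //; exact: measurable_heat_kernel_subr.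
Qed.

Lemma heat_semigroup_sup_le p l : 1 <= p -> 0 <= l -> exists2 K, 0 <= K &
  forall t f A x, 0 < t -> measurable_fun setT f -> 0 < A -> morrey_bound p l A f ->
  `|heat_semigroup mu t f x| <= K * A * heat_scale t `^ (- (l / p)).
Proof.
move=> p1 l0; have [K K0 hK] := integral_heat_kernel_morrey_le p1 l0.
exists K => // t f A x t0 mf A0 fA; rewrite -lee_fin.
exact: le_trans (heat_semigroup_abs_le x t0 mf) (hK t f A x t0 mf A0 fA).
Qed.

End heat_semigroup_bound.

(** Jensen's inequality for the weight [|w|], with a constant that allows a
    proof by [powR_young]: optimize
    [|\int w f| <= la K + la^(1-p) \int |w||f|^p] in [la]. *)
Lemma powR_weighted_average d (T : measurableType d) (R : realType)
    (m : {measure set T -> \bar R}) (p K : R) (w f : T -> R) :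
  1 <= p -> 0 <= K -> measurable_fun setT w -> measurable_fun setT f ->
  (\int[m]_y `|w y|%:E <= K%:E)%E ->
  ((`|\int[m]_y (w y * f y)| `^ p)%:E <=
    ((K + 1) `^ p)%:E * \int[m]_y (`|w y| * `|f y| `^ p)%:E)%E.
Proof.
move=> p1 K0 mw mf wK; have p0 : 0 < p by exact: lt_le_trans p1.
have mfp : measurable_fun setT (fun y => `|f y| `^ p).
  by apply: (measurableT_comp (@measurable_powR R _)); exact: measurableT_comp.
have mW : measurable_fun setT (fun y => (`|w y|)%:E).
  by apply/measurable_EFinP; exact: measurableT_comp.
have mV : measurable_fun setT (fun y => (`|w y| * `|f y| `^ p)%:E).
  by apply/measurable_EFinP/measurable_funM => //; exact: measurableT_comp.
have K1 : 0 < K + 1 by rewrite ltr_wpDl.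
have V0 : (0 <= \int[m]_y (`|w y| * `|f y| `^ p)%:E)%E.
  by apply: integral_ge0 => y _; rewrite lee_fin mulr_ge0 ?powR_ge0.
have hla la : 0 < la -> (`|\int[m]_y (w y * f y)|%:E <=
    (la * K)%:E + (la `^ (1 - p))%:E * \int[m]_y (`|w y| * `|f y| `^ p)%:E)%E.
  move=> la0.
  apply: (@le_trans _ _ (\int[m]_y (`|w y| * (la + la `^ (1 - p) * `|f y| `^ p))%:E)%E).
    apply: le_Rintegral_abs => [|y]; first exact: measurable_funM.
    rewrite normrM ler_wpM2l//.
    by have := powR_young p1 ler01 (normr_ge0 (f y)) la0; rewrite !powRr1// ltW.
  under eq_integral do rewrite mulrDr (mulrC _ la) mulrCA EFinD 2!EFinM.
  rewrite ge0_integralD//; last 4 first.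
  - by move=> y _; rewrite -EFinM lee_fin mulr_ge0// ltW.
  - by apply: measurable_funeM.
  - by move=> y _; rewrite -!EFinM lee_fin !mulr_ge0 ?powR_ge0.
  - by apply: measurable_funeM.
  rewrite ge0_integralZl//; last by rewrite lee_fin ltW.
  rewrite ge0_integralZl//; last by rewrite lee_fin powR_ge0.
  rewrite leeD2r// EFinM; apply: lee_wpmul2l => //; rewrite lee_fin ltW//.
move: V0 hla; set V := integral _ _ _; set a := `|_|.
case: V => [v|_ _|//]; last by rewrite gt0_muley ?leey// lte_fin powR_gt0.
rewrite lee_fin => v0 hla; rewrite -EFinM lee_fin.
have {}hla la : 0 < la -> a <= la * K + la `^ (1 - p) * v.
  by move=> /hla; rewrite -EFinM -EFinD lee_fin.
have a0 : 0 <= a by exact: normr_ge0.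
have [v_gt0|] := ltP 0 v; last first.
  (* For [v = 0] no choice of [la] is optimal; a small one shows that [a = 0]. *)
  move=> v_le0; have v_eq0 : v = 0 by apply/eqP; rewrite eq_le v_le0.
  suff -> : a = 0 by rewrite powR0 ?gt_eqF// mulr_ge0 ?powR_ge0.
  apply/eqP; rewrite eq_le a0 andbT leNgt; apply/negP => a_gt0.
  have := hla (a / (K + 1)) (divr_gt0 a_gt0 K1).
  rewrite v_eq0 mulr0 addr0 mulrAC ler_pdivlMr//.
  by rewrite mulrDr mulr1 gerDl leNgt a_gt0.
(* This [la] makes the two terms proportional. *)
pose la := v `^ p^-1; have la0 : 0 < la by exact: powR_gt0.
have lap : la `^ p = v by rewrite -powRrM mulVf ?gt_eqF// powRr1// ltW.
have := hla la la0; rewrite -[v in X in X -> _]lap -powRD ?(gt_eqF la0) ?implybT//.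
rewrite subrK powRr1 ?(ltW la0)// => ha.
rewrite -lap -powRM ?(ltW K1) ?(ltW la0)//.
apply: ge0_ler_powR; rewrite ?nnegrE ?(ltW p0)//.
  by rewrite mulr_ge0// ltW.
by rewrite mulrDl mul1r mulrC.
Qed.

Section heat_semigroup_morrey.
Context {R : realType} {N : nat}.
Implicit Types (x y z : 'rV[R]_N) (f g : 'rV[R]_N -> R) (p q l s r t A B : R).
Local Notation L := (@lebesgue_rV R N).
Variables (mu : R).
Hypothesis mu01 : 0 < mu <= 1.
Let mu0 : 0 < mu. Proof. by case/andP: mu01. Qed.
Local Notation k := (@heat_kernel R N mu).

(** Convolution with [|w|] averages translates of [|f|^p], all of which satisfy the
    same growth bound. *)
Lemma morrey_bound_convolution p l A f (w : 'rV[R]_N -> R) x r :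
  measurable_fun setT w -> measurable_fun setT f -> morrey_bound p l A f -> 0 < r ->
  (\int[L]_(y in eball x r) \int[L]_z (`|w (y - z)| * `|f z| `^ p)%:E <=
   (\int[L]_z `|w z|%:E) * (A `^ p * r `^ (N%:R - l))%:E)%E.
Proof.
move=> mw mf fA r0.
have msub := @measurable_sub_rV R N.
pose h z := `|f z| `^ p.
have mh : measurable_fun setT h.
  by apply: (measurableT_comp (@measurable_powR R _)); exact: measurableT_comp.
have mI : measurable_fun setT (\1_(eball x r) : 'rV[R]_N -> R).
  by apply: measurable_indic; exact: measurable_eball.
pose F (u : 'rV[R]_N * 'rV[R]_N) : \bar R :=
  (\1_(eball x r) u.1 * (`|w u.2| * h (u.1 - u.2)))%:E.
have F0 u : (0 <= F u)%E by rewrite lee_fin !mulr_ge0 ?powR_ge0.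
have mF : measurable_fun setT F.
  apply/measurable_EFinP; apply: measurable_funM.
    exact: measurableT_comp mI measurable_fst.
  apply: measurable_funM; last exact: measurableT_comp mh msub.
  apply: measurableT_comp => //; exact: measurableT_comp mw measurable_snd.
have -> : (\int[L]_(y in eball x r) \int[L]_z (`|w (y - z)| * `|f z| `^ p)%:E =
    \int[L]_y \int[L]_z F (y, z))%E.
  rewrite [LHS]integral_mkcond; apply: eq_integral => y _.
  rewrite /patch; case: ifPn => [yB|yB]; last first.
    by rewrite integral0_eq// => z _; rewrite /F indicE (negbTE yB) mul0r.
  rewrite -(ge0_integral_subr y)//.
  - apply: eq_integral => z _; rewrite /F/= indicE yB mul1r.
    by rewrite opprB addrC subrK.
  - apply/measurable_EFinP/measurable_funM => //.
    apply: measurableT_comp => //.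
    apply: (measurableT_comp mw).
    exact: measurableT_comp (measurable_addr_rV y) (@measurable_oppr_rV R N).
rewrite (fubini_tonelli F)//.
rewrite -ge0_integralZr//; last 2 first.
- by apply/measurable_EFinP; exact: measurableT_comp.
- by rewrite lee_fin mulr_ge0 ?powR_ge0.
apply: le_integral_ge0 => z _; first exact: integral_ge0.
have -> : (\int[L]_y F (y, z) =
    `|w z|%:E * \int[L]_y (\1_(eball x r) y * h (y - z))%:E)%E.
  rewrite -ge0_integralZl//.
  - by apply: eq_integral => y _; rewrite /F/= -EFinM mulrCA.
  - apply/measurable_EFinP/measurable_funM => //.
    exact: measurableT_comp mh (measurable_subr_rV z).
  - by move=> y _; rewrite lee_fin mulr_ge0 ?powR_ge0.
apply: lee_wpmul2l => //.
apply: le_trans (fA (x - z) r r0); rewrite -[leRHS]integral_mul_indic.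
rewrite -[leRHS](ge0_integral_addr (- z)); last 2 first.
- apply/measurable_EFinP/measurable_funM => //.
  by apply: measurable_indic; exact: measurable_eball.
- by move=> y; rewrite lee_fin mulr_ge0 ?powR_ge0.
rewrite le_eqVlt; apply/orP; left; apply/eqP; apply: eq_integral => y _.
rewrite (addrC (- z)); congr (_ * _)%:E.
have e : (y \in eball x r) = (y - z \in eball (x - z) r).
  by apply/idP/idP; rewrite !inE /eball/= opprB addrA subrK.
by rewrite !indicE e.
Qed.

(** [powR_weighted_average] reduces the claim to [morrey_bound_convolution] with
    the uniformly integrable kernel as weight. *)
Lemma heat_semigroup_morrey_bound p l : 1 <= p -> exists2 K, 0 <= K &
  forall t f A, 0 < t -> measurable_fun setT f -> 0 <= A -> morrey_bound p l A f ->
  morrey_bound p l (K * A) (heat_semigroup mu t f).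
Proof.
move=> p1; have p0 : 0 < p by exact: lt_le_trans p1.
have [K K0 hK] := @integral_heat_kernel_abs_le R N mu mu01.
exists ((K + 1) * (K + 1)) => [|t f A t0 mf A0 fA x r r0].
  by rewrite mulr_ge0 ?addr_ge0.
have K1 : 0 < K + 1 by rewrite ltr_wpDl.
have mk : measurable_fun setT (k t) by exact: measurable_heat_kernel.
pose V y := (\int[L]_z (`|k t (y - z)| * `|f z| `^ p)%:E)%E.
apply: (@le_trans _ _ (\int[L]_(y in eball x r) (((K + 1) `^ p)%:E * V y))%E).
  apply: le_integral_ge0 => y _; first by rewrite lee_fin powR_ge0.
  apply: powR_weighted_average => //; last exact: hK.
  exact: measurable_heat_kernel_subr.
have kK : (\int[L]_z `|k t z|%:E <= K%:E)%E.
  rewrite -(ge0_integral_subr 0)//; first exact: hK.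
  by apply/measurable_EFinP; exact: measurableT_comp.
rewrite ge0_integralZl//; last 4 first.
- exact: measurable_eball.
- apply: (measurable_funS measurableT) => //.
  apply: (@measurable_fun_fubini_tonelli_F _ _ _ _ _ L
    (fun u : 'rV[R]_N * 'rV[R]_N => (`|k t (u.1 - u.2)| * `|f u.2| `^ p)%:E)).
    apply/measurable_EFinP/measurable_funM.
      apply: measurableT_comp => //; exact: measurableT_comp mk (@measurable_sub_rV R N).
    apply: (measurableT_comp (@measurable_powR R _)).
    by apply: measurableT_comp => //; exact: measurableT_comp mf measurable_snd.
  by move=> u; rewrite lee_fin mulr_ge0 ?powR_ge0.
- move=> y _; apply: integral_ge0 => z _; by rewrite lee_fin mulr_ge0 ?powR_ge0.
- by rewrite lee_fin powR_ge0.
apply: le_trans (lee_wpmul2l _ (morrey_bound_convolution x mk mf fA r0)) _.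
  by rewrite lee_fin powR_ge0.
have Ar0 : 0 <= A `^ p * r `^ (N%:R - l) by rewrite mulr_ge0 ?powR_ge0.
apply: (@le_trans _ _ (((K + 1) `^ p)%:E * (K%:E * (A `^ p * r `^ (N%:R - l))%:E))%E).
  by apply: lee_wpmul2l; rewrite ?lee_fin ?powR_ge0//; exact: lee_wpmul2r.
rewrite -!EFinM lee_fin (powRM _ (mulr_ge0 (ltW K1) (ltW K1)) A0) powRM ?(ltW K1)//.
rewrite !mulrA ler_wpM2r ?powR_ge0// ler_wpM2r ?powR_ge0// ler_wpM2l ?powR_ge0//.
apply: le_trans (le1r_powR _ p1); first by rewrite lerDl.
by rewrite lerDr.
Qed.

End heat_semigroup_morrey.

(** * Decay of the semigroup *)

Section decay.
Context {R : realType} {N : nat}.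
Implicit Types (x y : 'rV[R]_N) (f g : 'rV[R]_N -> R) (p q l s r t A B : R).
Local Notation L := (@lebesgue_rV R N).
Variables (mu : R).
Hypothesis mu01 : 0 < mu <= 1.
Let mu0 : 0 < mu. Proof. by case/andP: mu01. Qed.
Local Notation k := (@heat_kernel R N mu).

(** Decay in [M^{p,l}] of the evolution of [f]. *)
Definition heat_vanishes p l f := forall e, 0 < e ->
  exists2 M, 0 < M & forall t, M <= t -> morrey_bound p l e (heat_semigroup mu t f).

(** A class of functions on which the integral defining the semigroup converges
    absolutely at every point, and which covers all the data of the theorem. *)
Definition some_morrey_bound f := exists p l A,
  [/\ 1 <= p, 0 <= l, 0 < A & morrey_bound p l A f].

(** For [q = p nu/l], interpolating between the bound [O(1)] in [M^{z,nu}] and the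
    sup bound [O(T^(-nu/z))] gives [O(T^(-(nu/z)(1-z/q)))] in [M^{q,nu}], which is
    included in [M^{p,l}].  The assumption [l/p < nu/z] is [z < q]. *)
Lemma heat_smoothing_vanishes z nu p l f A : 1 <= z -> 1 <= p -> 0 < l -> l <= nu ->
  l / p < nu / z -> measurable_fun setT f -> 0 < A -> morrey_bound z nu A f ->
  heat_vanishes p l f.
Proof.
move=> z1 p1 l0 lnu lpnuz mf A0 fA e e0.
have z0 : 0 < z by exact: lt_le_trans z1.
have p0 : 0 < p by exact: lt_le_trans p1.
have nu0 : 0 < nu by exact: lt_le_trans lnu.
(* [nu / q = l / p]: the spaces [M^{q,nu}] and [M^{p,l}] have the same scaling. *)
pose q := p * nu / l.
have pq : p <= q by rewrite /q ler_pdivlMr// ler_pM2l.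
have zq : z < q.
  by move: lpnuz; rewrite /q ltr_pdivrMr// mulrAC ltr_pdivlMr// ltr_pdivlMr// => h; lra.
have q0 : 0 < q by exact: lt_trans zq.
have [K K0 hK] := @heat_semigroup_sup_le R N mu mu01 z nu z1 (ltW nu0).
have [K' K'0 hK'] := @heat_semigroup_morrey_bound R N mu mu01 z nu z1.
pose C : R := 2 ^+ N + 1.
have C0 : 0 < C by rewrite ltr_wpDl// exprn_ge0.
pose a := 1 - z / q.
have a0 : 0 < a by rewrite subr_gt0 ltr_pdivrMr// mul1r.
pose H := (K * A) `^ a * (K' * A) `^ (z / q).
pose th := (2 * mu)^-1 * (nu / z) * a.
have th0 : 0 < th by rewrite !mulr_gt0 ?invr_gt0 ?mulr_gt0.
have [M M0 hM] := @powRN_small R H th (e / C) (mulr_ge0 (powR_ge0 _ _) (powR_ge0 _ _))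
  th0 (divr_gt0 e0 C0).
exists M => // t Mt; have t0 : 0 < t by exact: lt_le_trans Mt.
have mS := measurable_heat_semigroup mu01 t0 mf.
set D := K * A * heat_scale mu t `^ (- (nu / z)).
have D0 : 0 <= D by rewrite !mulr_ge0 ?powR_ge0 ?(ltW A0).
have := morrey_bound_interp z0 (ltW zq) (mulr_ge0 K'0 (ltW A0)) D0 mS
  (fun x => hK t f A x t0 mf A0 fA) (hK' t f A t0 mf (ltW A0) fA).
move=> /(morrey_boundW (B := e / C) (ltW q0) (mulr_ge0 (powR_ge0 _ _) (powR_ge0 _ _))) hq.
have {}hq : morrey_bound q nu (e / C) (heat_semigroup mu t f).
  apply: hq; apply: le_trans (hM t Mt); rewrite /H /D -/a.
  rewrite (@powRM _ (K * A)) ?mulr_ge0 ?powR_ge0 ?(ltW A0)//.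
  rewrite /heat_scale -!powRrM mulrAC.
  by have -> : (2 * mu)^-1 * (- (nu / z) * a) = - th by rewrite /th; ring.
have := morrey_bound_embed p1 pq (divr_gt0 e0 C0) mS hq.
have -> : nu * p / q = l by rewrite /q; field; rewrite ?gt_eqF.
by rewrite -/C mulrCA divff ?gt_eqF// mulr1.
Qed.

Lemma heat_semigroupD t f g : 0 < t -> measurable_fun setT f -> measurable_fun setT g ->
  some_morrey_bound f -> some_morrey_bound g ->
  heat_semigroup mu t (f \+ g) = heat_semigroup mu t f \+ heat_semigroup mu t g.
Proof.
move=> t0 mf mg fB gB.
have hint h x : measurable_fun setT h -> some_morrey_bound h ->
    L.-integrable setT (EFin \o (fun y => k t (x - y) * h y)).
  move=> mh [p [l [A [p1 l0 A0 hA]]]].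
  have [K K0 hK] := @integral_heat_kernel_morrey_le R N mu mu01 p l p1 l0.
  apply/integrableP; split.
    apply/measurable_EFinP/measurable_funM => //.
    exact: measurable_heat_kernel_subr.
  apply: le_lt_trans (ltry _); apply: le_trans (hK t h A x t0 mh A0 hA).
  by apply: le_integral_ge0 => y _; rewrite /= ?lee_fin ?normrM.
apply/funext => x; rewrite /heat_semigroup/= -RintegralD//; [|exact: hint|exact: hint].
by apply: eq_Rintegral => y _; rewrite /= mulrDr.
Qed.

Lemma heat_vanishesD p l f g : 1 <= p ->
  measurable_fun setT f -> measurable_fun setT g ->
  some_morrey_bound f -> some_morrey_bound g ->
  heat_vanishes p l f -> heat_vanishes p l g -> heat_vanishes p l (f \+ g).
Proof.
move=> p1 mf mg fB gB fv gv e e0; have e8 : 0 < e / 8 by rewrite divr_gt0.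
have [M M0 hM] := fv _ e8; have [M' M'0 hM'] := gv _ e8.
exists (M + M') => [|t Mt]; first exact: addr_gt0.
have t0 : 0 < t by apply: lt_le_trans Mt; exact: addr_gt0.
rewrite heat_semigroupD//.
have -> : e = 4 * (e / 8 + e / 8) by field.
apply: morrey_boundD; rewrite ?(ltW e8)//.
- exact: measurable_heat_semigroup.
- exact: measurable_heat_semigroup.
- by apply: hM; lra.
- by apply: hM'; lra.
Qed.

(** The semigroup is bounded on [M^{p,l}] uniformly in time, so the part [w]
    stays small. *)
Lemma heat_vanishes_approx p l f : 1 <= p -> 0 <= l -> (forall e, 0 < e -> exists v w,
    [/\ f = v \+ w, measurable_fun setT v /\ measurable_fun setT w,
        some_morrey_bound v, heat_vanishes p l v & morrey_bound p l e w]) ->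
  heat_vanishes p l f.
Proof.
move=> p1 l0 happ e e0.
have [K K0 hK] := @heat_semigroup_morrey_bound R N mu mu01 p l p1.
have K1 : 0 < K + 1 by rewrite ltr_wpDl.
have e8 : 0 < e / 8 by rewrite divr_gt0.
have eK : 0 < e / 8 / (K + 1) by rewrite divr_gt0.
have [v [w [-> [mv mw] vB vv we]]] := happ _ eK.
have [M M0 hM] := vv _ e8.
exists M => // t Mt; have t0 : 0 < t by exact: lt_le_trans Mt.
have wB : some_morrey_bound w by exists p, l, (e / 8 / (K + 1)).
rewrite heat_semigroupD//.
have -> : e = 4 * (e / 8 + e / 8) by field.
apply: morrey_boundD; rewrite ?(ltW e8)//.
- exact: measurable_heat_semigroup.
- exact: measurable_heat_semigroup.
- exact: hM.
have := hK t w _ t0 mw (ltW eK) we.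
apply: morrey_boundW; first exact: le_trans p1.
  by rewrite mulr_ge0// ltW.
by rewrite mulrCA ler_piMr ?(ltW e8)// ler_pdivrMr// mul1r lerDl.
Qed.

End decay.

(** * Truncation to balls, and the conclusion *)

Section conclusion.
Context {R : realType} {N : nat}.
Implicit Types (x y : 'rV[R]_N) (f g : 'rV[R]_N -> R) (p q l s r t A B : R).
Local Notation L := (@lebesgue_rV R N).
Variables (mu : R).
Hypothesis mu01 : 0 < mu <= 1.

Lemma cvg_morrey_norm0 p l (T : Type) (F : set_system T) (FF : Filter F)
    (u : T -> 'rV[R]_N -> R) : 0 < p ->
  morrey_norm p%:E l (u t) @[t --> F] --> 0%E ->
  forall e, 0 < e -> \forall t \near F, morrey_bound p l e (u t).
Proof.
move=> p0 /fine_cvgP[ufin /cvgr0Pnorm_le u0] e e0.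
near=> t; apply: morrey_norm_bound => //; first exact: ltW.
rewrite -[leLHS]fineK ?lee_fin; last by near: t.
apply: le_trans (ler_norm _) _; near: t; exact: u0.
Unshelve. all: by end_near. Qed.

(** Smallness of the norm for large times contains the membership in [M^{p,l}]. *)
Lemma morrey_vanishes_of_bound p l (u : R -> 'rV[R]_N -> R) : 0 < p ->
  (forall t, 0 < t -> measurable_fun setT (u t)) ->
  (forall e, 0 < e -> exists2 M, 0 < M & forall t, M <= t -> morrey_bound p l e (u t)) ->
  morrey_vanishes p%:E l u.
Proof.
move=> p0 mu_ ub.
have near_le e : 0 < e -> \forall t \near +oo,
    [/\ in_morrey p%:E l (u t), (0 <= morrey_norm p%:E l (u t))%E &
        (morrey_norm p%:E l (u t) <= e%:E)%E].
  move=> e0; have [M M0 hM] := ub e e0.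
  near=> t; have Mt : M <= t by near: t; apply: nbhs_pinfty_ge; exact: num_real.
  have mt := mu_ t (lt_le_trans M0 Mt).
  split; [|exact: morrey_norm_ge0|].
  - exact: morrey_bound_in p0 (ltW e0) mt (hM t Mt).
  - exact: morrey_bound_norm p0 (ltW e0) (hM t Mt).
split; first by apply: filterS (near_le 1 ltr01) => t [].
apply/fine_cvgP; split.
  apply: filterS (near_le 1 ltr01) => t [_ n0 n1].
  by rewrite ge0_fin_numE// (le_lt_trans n1)// ltry.
apply/cvgr0Pnorm_le => e e0; apply: filterS (near_le e e0) => t [_ n0 ne].
rewrite /= ger0_norm ?fine_ge0// -lee_fin fineK//.
by rewrite ge0_fin_numE// (le_lt_trans ne)// ltry.
Unshelve. all: by end_near. Qed.

(** A growth bound with [l = N] says that the integrals over all balls are bounded,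
    so [|f|^p] is integrable over the whole space. *)
Lemma integral_eball_tail_small p A f e : 0 < p -> 0 <= A -> measurable_fun setT f ->
  morrey_bound p N%:R A f -> 0 < e ->
  exists2 r, 0 < r & (\int[L]_(y in ~` eball 0 r) (`|f y| `^ p)%:E <= e%:E)%E.
Proof.
move=> p0 A0 mf fA e0.
pose F n := eball (0 : 'rV[R]_N) n.+1%:R.
have mF n : measurable (F n) by exact: measurable_eball.
have ndF : nondecreasing_seq F.
  move=> m n mn; apply/subsetPset => y; rewrite /F /eball/= => /lt_le_trans; apply.
  by rewrite ler_nat.
have FT : \bigcup_n F n = setT.
  apply/seteqP; split => // y _; exists (Num.bound (enorm y)) => //.
  rewrite /F /eball/= subr0; apply: lt_le_trans (archi_boundP (enorm_ge0 y)) _.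
  by rewrite ler_nat.
have fp0 n y : F n y -> (0 <= (`|f y| `^ p)%:E)%E by rewrite lee_fin powR_ge0.
have := @ge0_nondecreasing_set_cvg_integral _ _ _ _ _ L ndF mF
  (fun n => measurable_norm_powR p (D := F n) mf) fp0.
rewrite FT => cvgI.
set I := (\int[L]_y _)%E in cvgI.
have I0 : (0 <= I)%E by exact: integral_norm_powR_ge0.
have IA : (I <= (A `^ p)%:E)%E.
  apply: cvge_to_le cvgI _; apply: nearW => n.
  by apply: le_trans (fA 0 _ (ltr0Sn _ _)) _; rewrite subrr powRr0 mulr1.
have Ifin : I \is a fin_num by rewrite ge0_fin_numE// (le_lt_trans IA)// ltry.
have [n hn] : exists n, (I - e%:E < \int[L]_(y in F n) (`|f y| `^ p)%:E)%E.
  apply/not_existsP => h; have : (I <= I - e%:E)%E.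
    by apply: cvge_to_le cvgI _; apply: nearW => n; rewrite leNgt; exact/negP/h.
  by rewrite -(fineK Ifin) -EFinD lee_fin leNgt ltrBlDr ltrDl e0.
exists n.+1%:R => //.
have mfp : measurable_fun setT (fun y => `|f y| `^ p).
  by apply: (measurableT_comp (@measurable_powR R _)); exact: measurableT_comp.
have IE := ge0_integral_eball_split 0 n.+1%:R mfp (fun y => powR_ge0 _ _).
rewrite -/I in IE; move: hn Ifin; rewrite {}IE -/(F n).
have := integral_norm_powR_ge0 p f (~` F n).
have := integral_norm_powR_ge0 p f (F n).
case: (integral _ (F n) _) => [a| |]; case: (integral _ (~` F n) _) => [b| |] //= _ _.
by rewrite -!EFinD !lee_fin lte_fin => h _; lra.
Qed.

Lemma measurable_restrict_eball f x r : measurable_fun setT f ->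
  measurable_fun setT (\1_(eball x r) \* f).
Proof.
move=> mf; apply: measurable_funM => //; apply: measurable_indic.
exact: measurable_eball.
Qed.

(** The integral of the truncation over any ball is at most that of [|f|] over the
    truncating ball. *)
Lemma restrict_eball_bound p l A f x r : 1 <= p -> 0 < A -> measurable_fun setT f ->
  morrey_bound p l A f -> 0 < r ->
  exists2 B, 0 < B & morrey_bound 1 N%:R B (\1_(eball x r) \* f).
Proof.
move=> p1 A0 mf fA r0.
have C0 : 0 < (2 ^+ N + 1 : R) by rewrite ltr_wpDl// exprn_ge0.
have fr := morrey_bound_embed (lexx 1) p1 A0 mf fA x r0.
set B := _ * _ in fr; have B0 : 0 < B.
  by rewrite mulr_gt0 ?powR_gt0// mulr_gt0.
exists B; first exact: B0.
move=> y s s0; rewrite subrr powRr0 mulr1 (powRr1 (ltW B0)).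
apply: le_trans fr; rewrite integral_mkcond [leRHS]integral_mkcond.
apply: le_integral_ge0 => z _.
  by rewrite /patch; case: ifP => _; rewrite lee_fin ?powR_ge0.
rewrite /patch; case: ifP => _; last first.
  by case: ifP => _; rewrite lee_fin ?powR_ge0.
rewrite /= indicE; case: ifP => _; first by rewrite mul1r.
by rewrite mul0r normr0 powR0 ?oner_eq0.
Qed.

Lemma off_ballE f x r : f = (\1_(eball x r) \* f) \+ off_ball x r f.
Proof. by apply/funext => y; rewrite /off_ball/=; ring. Qed.

Lemma measurable_off_ball f x r : measurable_fun setT f ->
  measurable_fun setT (off_ball x r f).
Proof.
move=> mf; apply: measurable_funM => //; apply: measurable_funB => //.
by apply: measurable_indic; exact: measurable_eball.
Qed.

Lemma off_ball_bound_small p A f e : 0 < p -> 0 <= A -> measurable_fun setT f ->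
  morrey_bound p N%:R A f -> 0 < e ->
  exists2 r, 0 < r & morrey_bound p N%:R e (off_ball 0 r f).
Proof.
move=> p0 A0 mf fA e0.
have [r r0 hr] := integral_eball_tail_small p0 A0 mf fA (powR_gt0 p e0).
exists r => // x s s0; rewrite subrr powRr0 mulr1; apply: le_trans hr.
rewrite integral_mkcond [leRHS]integral_mkcond; apply: le_integral_ge0 => y _.
  by rewrite /patch; case: ifP => _; rewrite lee_fin ?powR_ge0.
rewrite /patch /off_ball indicE in_setC; case: (y \in eball 0 r) => /=.
  by rewrite subrr mul0r normr0 powR0 ?gt_eqF//; case: ifP.
by rewrite subr0 mul1r; case: ifP => _ //; rewrite lee_fin powR_ge0.
Qed.

Lemma restrict_eball_vanishes p l f A x r : 1 <= p -> 0 < l -> l <= N%:R ->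
  l / p < N%:R -> measurable_fun setT f -> 0 < A -> morrey_bound p l A f -> 0 < r ->
  some_morrey_bound (\1_(eball x r) \* f) /\ heat_vanishes mu p l (\1_(eball x r) \* f).
Proof.
move=> p1 l0 lN lpN mf A0 fA r0.
have [B B0 fB] := restrict_eball_bound x p1 A0 mf fA r0.
split; first by exists 1, N%:R, B.
apply: (heat_smoothing_vanishes mu01 (lexx 1) p1 l0 lN _ _ B0 fB); rewrite ?divr1//.
exact: measurable_restrict_eball.
Qed.

(** Division by an infinite exponent gives [0], which the positive number [a]
    rules out; so exponents in the theorem are finite. *)
Lemma finite_exponent (z : \bar R) (nu a : R) : 0 < a -> (1 <= z)%E ->
  (a%:E < nu%:E / z)%E \/ (nu%:E / z = a%:E)%E ->
  exists2 r, z = r%:E & 1 <= r /\ (nu%:E / z)%E = (nu / r)%:E.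
Proof.
move=> a0; case: z => [r| |]; last by [].
- rewrite lee_fin => r1 _; exists r => //; split => //.
  by rewrite inver gt_eqF// (lt_le_trans ltr01).
- by move=> _; rewrite invey mule0 => -[|[/eqP]]; [rewrite lte_fin ltNge ltW|rewrite lt_eqF].
Qed.

End conclusion.

Theorem theorem6p1 (R : realType) (N : nat) (mu p l : R) (u0 : 'rV[R]_N -> R) :
  0 < mu <= 1 -> 1 <= p -> 0 < l <= N%:R ->
  in_morrey p%:E l u0 ->
  (l = N%:R /\ 1 < p) \/
  (l < N%:R /\
   [\/ exists (z : \bar R) (nu : R) (u : nat -> 'rV[R]_N -> R),
         [/\ (1 <= z)%E, l <= nu <= N%:R, (l%:E / p%:E < nu%:E / z)%E,
             forall n, in_morrey z nu (u n) /\ in_morrey p%:E l (u n) &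
             morrey_norm p%:E l (u n \- u0) @[n --> \oo] --> 0%E],
       exists (x : 'rV[R]_N) (r : R) (z : \bar R) (nu : R),
         [/\ 0 < r, (1 <= z)%E, l <= nu <= N%:R,
             (l%:E / p%:E < nu%:E / z)%E & in_morrey z nu (off_ball x r u0)] |
       exists x : 'rV[R]_N,
         morrey_norm p%:E l (off_ball x r u0) @[r --> +oo] --> 0%E]) ->
  morrey_vanishes p%:E l (fun t => heat_semigroup mu t u0) /\
  (forall (q : \bar R) (s : R),
     (1 <= q)%E -> 0 < s <= l -> (s%:E / q = l%:E / p%:E)%E ->
     morrey_vanishes q s (fun t => heat_semigroup mu t u0)).
Proof.
move=> mu01 p1 /andP[l0 lN] u0M hyp.
have p0 : 0 < p by exact: lt_le_trans p1.
have [mu0 [A A0 u0A]] := in_morrey_bound p0 u0M.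
have lp0 : 0 < l / p by rewrite divr_gt0.
have lpE : (l%:E / p%:E = (l / p)%:E)%E by rewrite inver gt_eqF.
have lpN : l / p < N%:R.
  rewrite ltr_pdivrMr//; case: hyp => [[-> p_gt1]|[lN' _]].
    by rewrite ltr_pMr// (lt_le_trans l0).
  by rewrite (lt_le_trans lN')// ler_peMr.
have inner x r : 0 < r -> some_morrey_bound (\1_(eball x r) \* u0) /\
    heat_vanishes mu p l (\1_(eball x r) \* u0).
  move=> r0; exact: (restrict_eball_vanishes mu01 x p1 l0 lN lpN mu0 A0 u0A r0).
have u0V : heat_vanishes mu p l u0.
  have off_approx x : (forall e, 0 < e -> exists2 r, 0 < r &
      morrey_bound p l e (off_ball x r u0)) -> heat_vanishes mu p l u0.
    move=> hoff; apply: (heat_vanishes_approx mu01 p1 (ltW l0)) => e /hoff[r r0 hr].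
    have [vB vV] := inner x r r0.
    exists (\1_(eball x r) \* u0), (off_ball x r u0); split; [| |exact: vB|exact: vV|exact: hr].
    - exact: off_ballE.
    - by split; [exact: measurable_restrict_eball|exact: measurable_off_ball].
  case: hyp => [[lNe p_gt1]|[lN' [[z [nu [u [z1 /andP[lnu nuN] lz uM ucvg]]]]|
      [x [r [z [nu [r0 z1 /andP[lnu nuN] lz offM]]]]]|[x hx]]]].
  - apply: (off_approx 0) => e e0; rewrite lNe in u0A *.
    exact: off_ball_bound_small p0 (ltW A0) mu0 u0A e0.
  - apply: (heat_vanishes_approx mu01 p1 (ltW l0)) => e e0.
    rewrite lpE in lz.
    have [r zr [r1 zE]] := finite_exponent lp0 z1 (or_introl lz).
    rewrite zE lte_fin in lz; rewrite {}zr in uM.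
    have [n un] := filter_ex (cvg_morrey_norm0 _ p0 ucvg e0).
    have [[un1 _] _] := (uM n, tt).
    have [mun [B B0 unB]] := in_morrey_bound (lt_le_trans ltr01 r1) un1.
    exists (u n), (u0 \- u n); split.
    + by apply/funext => y /=; rewrite subrKC.
    + by split; [exact: mun|exact: measurable_funB].
    + by exists r, nu, B; split; [| exact: ltW (lt_le_trans l0 lnu) | |].
    + exact (heat_smoothing_vanishes mu01 r1 p1 l0 lnu lz mun B0 unB).
    + move=> y s s0; have := un y s s0.
      by under eq_integral do rewrite /= distrC.
  - rewrite lpE in lz.
    have [z' zr [z1' zE]] := finite_exponent lp0 z1 (or_introl lz).
    rewrite zE lte_fin in lz; rewrite {}zr in offM.
    have [moff [B B0 offB]] := in_morrey_bound (lt_le_trans ltr01 z1') offM.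
    have [vB vV] := inner x r r0.
    have offS : some_morrey_bound (off_ball x r u0).
      by exists z', nu, B; split; [| exact: ltW (lt_le_trans l0 lnu) | |].
    have offV : heat_vanishes mu p l (off_ball x r u0).
      exact (heat_smoothing_vanishes mu01 z1' p1 l0 lnu lz moff B0 offB).
    rewrite (off_ballE u0 x r).
    exact (heat_vanishesD mu01 p1 (measurable_restrict_eball x r mu0) moff vB offS vV offV).
  - apply: (off_approx x) => e e0.
    have near_gt0 : \forall r \near +oo, (0 : R) < r.
      exact: nbhs_pinfty_gt (num_real 0).
    have [r [hr r0]] := filter_ex (filterI (cvg_morrey_norm0 _ p0 hx e0) near_gt0).
    by exists r.
have mS t : 0 < t -> measurable_fun setT (heat_semigroup mu t u0).
  by move=> t0; exact: measurable_heat_semigroup.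
split; first exact: morrey_vanishes_of_bound p0 mS u0V.
move=> q s q1 /andP[s0 sl]; rewrite lpE => sq.
have [r qr [r1 sE]] := finite_exponent lp0 q1 (or_intror sq).
have srlp : s / r = l / p by apply: EFin_inj; rewrite -sE.
have r0 : 0 < r by exact: lt_le_trans r1.
have sE' : l * r / p = s.
  by rewrite mulrAC -srlp divfK// gt_eqF.
have rp : r <= p.
  by move: sl; rewrite -sE' ler_pdivrMr// ler_pM2l.
rewrite qr; apply: (morrey_vanishes_of_bound r0 mS) => e e0.
have C0 : 0 < (2 ^+ N + 1 : R) by rewrite ltr_wpDl// exprn_ge0.
have [M M0 hM] := u0V _ (divr_gt0 e0 C0).
exists M => // t Mt; have t0 : 0 < t by exact: lt_le_trans Mt.
have := morrey_bound_embed r1 rp (divr_gt0 e0 C0) (mS t t0) (hM t Mt).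
by rewrite sE' mulrCA divff ?gt_eqF// mulr1.
Qed.
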